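(* Let $(d(n))_{n\ge1}$ be a sequence of positive integers such that $d(n)\to\infty$ and $d(n)=n^{o(1)}$ as $n\to\infty$. Let $A_n$ be the sum of $d(n)$ independent uniform random $n\times n$ permutation matrices, and let $\lambda_1,\dots,\lambda_n$ be the complex eigenvalues of $A_n$ (with multiplicity), ordered by decreasing modulus: $d(n)=\lambda_1\ge|\lambda_2|\ge\dots\ge|\lambda_n|$. Then for any $\varepsilon>0$, $$\mathbb{P}\left(|\lambda_2|>\sqrt{d(n)}\,(1+\varepsilon)\right)\xrightarrow[n\to\infty]{}0.$$
   Context: A uniform random permutation matrix of size $n\times n$ is $P=(\mathbf 1_{\pi(i)=j})_{1\le i,j\le n}$ with $\pi$ uniform in the symmetric group $S_n$. The condition $d(n)=n^{o(1)}$ means $\log d(n)=o(\log n)$ as $n\to\infty$. *)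

(* Defs.v *)
From HB Require Import structures.
From mathcomp Require Import all_boot all_order all_algebra all_fingroup.
From mathcomp Require Import all_classical all_reals all_analysis.
From mathcomp Require Import complex.

Set Implicit Arguments.
Unset Strict Implicit.
Unset Printing Implicit Defensive.

Import Order.TTheory GRing.Theory Num.Theory numFieldNormedType.Exports.

Local Open Scope classical_set_scope.
Local Open Scope ring_scope.

(* Finite-valued random variables: the finite type [V] carries the discrete
   sigma-algebra, whence the quantification over all [B : set V]. *)
Definition discrete_rv (disp : measure_display) (T : measurableType disp)
  (V : finType) (X : T -> V) : Prop :=
  forall B : set V, measurable (X @^-1` B).

Definition uniform_law (R : realType) (disp : measure_display)
  (T : measurableType disp) (P : probability T R) (V : finType)
  (X : T -> V) : Prop :=
  forall v : V, P (X @^-1` [set v]) = (#|V|%:R^-1)%:E.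

Definition mutually_independent (R : realType) (disp : measure_display)
  (T : measurableType disp) (P : probability T R) (I V : finType)
  (X : I -> T -> V) : Prop :=
  forall (J : {set I}) (B : I -> set V),
    P (\bigcap_(i in [set` J]) (X i @^-1` B i)) =
    (\prod_(i in J) P (X i @^-1` B i))%E.

Definition iid_uniform (R : realType) (disp : measure_display)
  (T : measurableType disp) (P : probability T R) (I V : finType)
  (X : I -> T -> V) : Prop :=
  [/\ forall i, discrete_rv (X i),
      forall i, uniform_law P (X i)
    & mutually_independent P X].

(* [perm_mx s] has entry [(s i == j)%:R] at [(i, j)]. *)
Definition sum_perm_mx (R : realType) (n k : nat) (s : 'I_k -> 'S_n) :
  'M[R[i]]_n := \sum_(j < k) perm_mx (s j).

(* [l] lists the roots of the characteristic polynomial of [A] with algebraic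
   multiplicity, by nonincreasing modulus (ties broken arbitrarily). *)
Definition ordered_eigenvalues (R : realType) (n : nat) (A : 'M[R[i]]_n)
  (l : n.-tuple R[i]) : Prop :=
  char_poly A = \prod_(z <- l) ('X - z%:P) /\
  sorted (fun z w : R[i] => `|w| <= `|z|) l.

(* Main.v *)
Require Import Defs.
From HB Require Import structures.
From mathcomp Require Import all_boot all_order all_algebra all_fingroup.
From mathcomp Require Import all_classical all_reals all_analysis.
From mathcomp Require Import complex ring lra zify.

Set Implicit Arguments.
Unset Strict Implicit.
Unset Printing Implicit Defensive.

Import Order.TTheory GRing.Theory Num.Theory numFieldNormedType.Exports.

Local Open Scope ring_scope.

(* Let f(z) = det(1 - z (A - (d/n) J)), J the all-ones matrix, whose roots are the inverses
   of the eigenvalues of A other than d. By Schur orthogonality for the exterior powers of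
   the standard representation of S_n (pairwise inequivalent and irreducible), the
   coefficient c_k of z^k satisfies E c_k^2 <= d^k for all k, n and d: the exact value is a
   sum over the colourings phi : [k] -> [d] with class sizes k_j of the weights
   (n-1)_k / prod_j (n-1)_(k_j) <= 1. Counting closed walks shows that, for fixed k and n
   large, the power sums t_k = tr A^k - d^k satisfy E |t_k| <= 4 k d^(k/2); this is where
   d = n^o(1) enters. Newton's identities say that f times the exponential of the truncated
   series sum_(k <= K) t_k z^k / k is 1 + O(z^(K+1)). With T := 1 / sqrt d as unit of length,
   both factors have, with high probability, coefficients that are summable on a disc of
   radius rho T, rho < 1, with a bound independent of K; so for K large this product cannot
   vanish on a smaller disc, and f has no root of modulus at most T / (1 + eps). *)

(** * Minors indexed by tuples *)

(** A trace method alone would need closed walks of length of order log n, where counting is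
    delicate. Here the coefficients of every order up to n are controlled algebraically, so walks
    keep a length at most K, fixed before n. Each walk count may then lose a constant depending on
    K; since d tends to infinity, one extra factor d absorbs all of them. The algebra treats the d
    permutations as a single block diagonal matrix indexed by pairs (colour, row), on which the
    product of d symmetric groups acts; A - (d/n) J is recovered by forgetting colours. Order of
    choices: eps fixes the radii; these and the tolerated failure probability fix the bounds on both
    factors; the bounds fix K; and K fixes how large n must be. The last step is Markov's
    inequality, applied once to each factor. *)

Section Determinants.

Variable R : comPzRingType.

(** Sylvester's identity, from two triangular factorisations of one block matrix. It later reduces
    determinants to size [k] or to diagonal ones. *)
Lemma det_add_mulC m n (A : 'M[R]_(m, n)) (B : 'M[R]_(n, m)) :
  \det (1%:M + A *m B) = \det (1%:M + B *m A).
Proof.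
have E1 : block_mx 1%:M (- B) A 1%:M =
    block_mx 1%:M 0 A 1%:M *m block_mx 1%:M (- B) 0 (1%:M + A *m B).
  rewrite mulmx_block !mul1mx !mul0mx !mulmx1 !addr0 mulmxN.
  by rewrite [1%:M + _]addrC addKr.
have E2 : block_mx 1%:M (- B) A 1%:M =
    block_mx (1%:M + B *m A) (- B) 0 1%:M *m block_mx 1%:M 0 A 1%:M.
  rewrite mulmx_block !mul1mx !mul0mx !mulmx0 !mulmx1 !add0r mulNmx.
  by rewrite addrK.
have := congr1 determinant E2.
rewrite E1 !det_mulmx !det_lblock !det_ublock !det1 !mul1r !mulr1.
by [].
Qed.

(* Minors with ordered, possibly repeated row and column indices: exterior powers are
   encoded by tuples, at the price of a factor [k`!] in each contraction. *)
Definition sub_det (S T : Type) k (a : S -> T -> R) (x : 'I_k -> S)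
  (y : 'I_k -> T) : R := \det (\matrix_(s, t) a (x s) (y t)).

Lemma eq_sub_det (S T : Type) k (a b : S -> T -> R) (x : 'I_k -> S)
    (y : 'I_k -> T) :
  (forall s t, a (x s) (y t) = b (x s) (y t)) ->
  sub_det a x y = sub_det b x y.
Proof.
by move=> ab; congr determinant; apply/matrixP => s t; rewrite !mxE.
Qed.

Lemma sub_det_tr (S T : Type) k (a : S -> T -> R) (x : 'I_k -> S)
    (y : 'I_k -> T) :
  sub_det a x y = sub_det (fun t s => a s t) y x.
Proof.
rewrite /sub_det -det_tr; congr determinant.
by apply/matrixP => s t; rewrite !mxE.
Qed.

Lemma sub_det_perml (S : finType) (T : Type) k (a : S -> T -> R)
    (x : {ffun 'I_k -> S}) (y : 'I_k -> T) (r : 'S_k) :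
  sub_det a [ffun s => x (r s)] y = (-1) ^+ r * sub_det a x y.
Proof.
rewrite /sub_det -det_perm -det_mulmx -row_permE; congr determinant.
by apply/matrixP => s t; rewrite !mxE ffunE.
Qed.

Lemma sub_det_permr (S : Type) (T : finType) k (a : S -> T -> R)
    (x : 'I_k -> S) (y : {ffun 'I_k -> T}) (r : 'S_k) :
  sub_det a x [ffun s => y (r s)] = (-1) ^+ r * sub_det a x y.
Proof. by rewrite sub_det_tr sub_det_perml -sub_det_tr. Qed.

Lemma sub_det_noninj (S T : Type) k (a : S -> T -> R)
    (x : 'I_k -> S) (y : 'I_k -> T) (s t : 'I_k) :
  s != t -> x s = x t -> sub_det a x y = 0.
Proof.
by move=> st xst; apply: (determinant_alternate st) => u; rewrite !mxE xst.
Qed.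

(** Multilinearity in the rows: each row of the product is a combination of rows of [b]. *)
Lemma sub_det_sum (S T U : finType) k (a : S -> T -> R) (b : T -> U -> R)
    (x : 'I_k -> S) (y : 'I_k -> U) :
  \sum_(z : {ffun 'I_k -> T}) (\prod_s a (x s) (z s)) * sub_det b z y =
  sub_det (fun i j => \sum_t a i t * b t j) x y.
Proof.
rewrite /sub_det /determinant.
under eq_bigr do rewrite mulr_sumr.
rewrite exchange_big /=; apply: eq_bigr => r _.
under [in RHS]eq_bigr do rewrite mxE.
rewrite bigA_distr_bigA /= mulr_sumr; apply: eq_bigr => z _.
rewrite mulrCA -big_split /=; congr (_ * _); apply: eq_bigr => s _.
by rewrite !mxE.
Qed.

Lemma cauchy_binet (S T U : finType) k (a : S -> T -> R) (b : T -> U -> R)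
    (x : 'I_k -> S) (y : 'I_k -> U) :
  \sum_(z : {ffun 'I_k -> T}) sub_det a x z * sub_det b z y =
  k`!%:R * sub_det (fun i j => \sum_t a i t * b t j) x y.
Proof.
rewrite -sub_det_sum.
under eq_bigr => z _ do rewrite {1}/sub_det /determinant mulr_suml.
rewrite exchange_big /=.
(* Every permutation in the expansion of the first determinant contributes the same sum: once [z] is
   reindexed by its inverse, the two signs cancel. *)
have -> : k`!%:R = \sum_(r : 'S_k) 1 :> R.
  by rewrite sumr_const card_Sn.
rewrite mulr_suml; apply: eq_bigr => r _; rewrite mul1r.
rewrite (reindex (fun z : {ffun 'I_k -> T} => [ffun s => z ((r^-1)%g s)])) /=; last first.
  exists (fun z : {ffun 'I_k -> T} => [ffun s => z (r s)]) => z _;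
    by apply/ffunP => s; rewrite !ffunE ?permK ?permKV.
apply: eq_bigr => z _.
rewrite sub_det_perml odd_permV mulrA; congr (_ * _).
rewrite mulrAC -expr2 sqrr_sign mul1r.
by apply: eq_bigr => s _; rewrite mxE ffunE permK.
Qed.

End Determinants.

Section PrincipalMinors.

Variables (R : comPzRingType) (n : nat).
Implicit Types (N : 'M[R]_n) (A : {set 'I_n}).

(** Rows outside [A] are those of the identity: the determinant is the principal minor on [A], while
    the size stays [n]. *)
Definition principal_mx A N : 'M[R]_n :=
  \matrix_(i, j) if i \in A then N i j else (i == j)%:R.

Lemma det_add1 N : \det (1%:M + N) = \sum_(A : {set 'I_n}) \det (principal_mx A N).
Proof.
rewrite /determinant exchange_big /=; apply: eq_bigr => r _.
rewrite -mulr_sumr; congr (_ * _).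
under eq_bigr do rewrite !mxE addrC.
rewrite bigA_distr; apply: eq_bigr => A _.
by apply: eq_bigr => i _; rewrite !mxE.
Qed.

Lemma det_principal_mxZ A N c :
  \det (principal_mx A (c *: N)) = c ^+ #|A| * \det (principal_mx A N).
Proof.
have -> : principal_mx A (c *: N) =
    diag_mx (\row_i (if i \in A then c else 1)) *m principal_mx A N.
  apply/matrixP => i j; rewrite mul_diag_mx !mxE.
  by case: ifP => _; rewrite ?mul1r.
rewrite det_mulmx det_diag; congr (_ * _).
under eq_bigr do rewrite mxE.
by rewrite -big_mkcond /= prodr_const.
Qed.

(** With E the matrix selecting the indices listed by [x], the left matrix is 1 + E E^T (N - 1);
    Sylvester's identity turns its determinant into that of E^T N E. *)
Lemma det_principal_mx A N k (x : {ffun 'I_k -> 'I_n}) :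
  injective x -> [set x s | s : 'I_k]%SET = A ->
  \det (principal_mx A N) = sub_det N x x.
Proof.
move=> xI xA; pose E : 'M[R]_(n, k) := \matrix_(i, s) (i == x s)%:R.
have EE : E^T *m E = 1%:M.
  apply/matrixP => s t; rewrite !mxE (bigD1 (x s)) //= !mxE eqxx mul1r.
  rewrite big1 ?addr0 ?(inj_eq xI) // => i ins.
  by rewrite !mxE (negPf ins) mul0r.
have ED : principal_mx A N = 1%:M + E *m (E^T *m (N - 1%:M)).
  apply/matrixP => i j; rewrite mulmxA !mxE.
  rewrite (bigD1 i) //= [X in _ + (_ + X)]big1 ?addr0; last first.
    move=> l lni; rewrite !mxE big1 ?mul0r // => s _.
    by rewrite !mxE; case: eqP => [<-|]; rewrite ?mul0r // eq_sym in lni *; 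
      rewrite (negPf lni) mulr0.
  rewrite !mxE -xA; case: imsetP => [[s _ ->]|nx].
    rewrite (bigD1 s) //= !mxE eqxx mul1r big1 ?addr0; last first.
      by move=> t ts; rewrite !mxE (inj_eq xI) eq_sym (negPf ts) mul0r.
    by rewrite mul1r addrC subrK.
  rewrite big1 ?mul0r ?addr0 // => s _; rewrite !mxE.
  by case: eqP => [ixs|]; [case: nx; exists s|rewrite mul0r].
rewrite ED det_add_mulC -mulmxA mulmxBl mul1mx mulmxBr EE addrC subrK.
congr determinant; apply/matrixP => s t; rewrite !mxE (bigD1 (x s)) //= !mxE.
rewrite eqxx mul1r [X in _ + X]big1 ?addr0; last first.
  by move=> i ins; rewrite !mxE (negPf ins) mul0r.
rewrite (bigD1 (x t)) //= !mxE eqxx mulr1 big1 ?addr0 // => i ins.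
by rewrite !mxE (negPf ins) mulr0.
Qed.

(** Tuples with a repetition contribute zero, and each set of size [k] is the image of k! injective
    tuples. *)
Lemma sum_principal_minors N k :
  \sum_(x : {ffun 'I_k -> 'I_n}) sub_det N x x =
  k`!%:R * \sum_(A : {set 'I_n} | #|A| == k) \det (principal_mx A N).
Proof.
rewrite (bigID (fun x : {ffun 'I_k -> 'I_n} => injectiveb x)) /=.
rewrite [X in _ + X]big1 ?addr0; last first.
  move=> x /injectivePn[s [t st xst]]; exact: sub_det_noninj st xst.
rewrite (partition_big (fun x : {ffun 'I_k -> 'I_n} => [set x s | s : 'I_k]%SET)
  (fun A => #|A| == k)) /=; last first.
  by move=> x /injectiveP xI; rewrite card_imset // card_ord.
rewrite mulr_sumr; apply: eq_bigr => A /eqP cA.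
transitivity (\sum_(x : {ffun 'I_k -> 'I_n} |
   injectiveb x && ([set x s | s : 'I_k]%SET == A)) \det (principal_mx A N)).
  apply: eq_bigr => x /andP[/injectiveP xI /eqP xA].
  by rewrite (det_principal_mx N xI xA).
rewrite sumr_const mulr_natl; congr (_ *+ _).
transitivity (#|[set f : {ffun 'I_k -> 'I_n} in ffun_on (mem A) | injectiveb f]%SET|).
  apply: eq_card => x; rewrite !inE.
  apply/andP/andP => [[xI /eqP <-]|[/ffun_onP xA xI]].
    by split=> //; apply/ffun_onP => s; apply: imset_f.
  split=> //; rewrite eqEcard card_imset ?card_ord ?cA ?leqnn ?andbT //.
    by apply/fintype.subsetP => i /imsetP[s _ ->]; apply: xA.
  exact/injectiveP.
by rewrite card_inj_ffuns_on card_ord cA ffactnn.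
Qed.

End PrincipalMinors.

(** Both sides are k! times the trace of the [k]-th exterior power of [N]. *)
Lemma coef_det_add1X (R : comNzRingType) n (N : 'M[R]_n) k :
  k`!%:R * (\det (1%:M + 'X *: map_mx polyC N))`_k =
  \sum_(x : {ffun 'I_k -> 'I_n}) sub_det N x x.
Proof.
rewrite sum_principal_minors det_add1; congr (_ * _).
rewrite coef_sum [RHS]big_mkcond; apply: eq_bigr => A _.
have -> : \det (principal_mx A ('X *: map_mx polyC N)) =
    'X^#|A| * (\det (principal_mx A N))%:P.
  rewrite det_principal_mxZ; congr (_ * _).
  rewrite -det_map_mx; congr determinant; apply/matrixP => i j; rewrite !mxE.
  by case: ifP => // _; rewrite rmorph_nat.
rewrite coefXnM coefC; case: ltngtP => [//|kA|->]; last by rewrite subnn.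
by rewrite subn_eq0 leqNgt kA.
Qed.

(** * A Schur lemma for alternating functions *)

Section ColouredSchur.

Variables (R : realFieldType) (W J : finType) (col : W -> J) (k : nat).
Implicit Types (v w : {ffun 'I_k -> W} -> {ffun 'I_k -> W} -> R).
Implicit Types (X Y : {ffun 'I_k -> W}).

(** Meant for points [p] and [q] of the same colour: a transposition of the product group, acting on
    tuples. *)
Definition swap_colours p q X : {ffun 'I_k -> W} := [ffun s => tperm p q (X s)].

Definition replace X (s : 'I_k) p : {ffun 'I_k -> W} :=
  [ffun t => if t == s then p else X t].

(** Labels the constituents of the exterior power: tuples of one content correspond to a product of
    exterior powers, one for each colour. *)
Definition content X : {ffun J -> nat} := [ffun j => #|[pred s | col (X s) == j]|].

(* The abstract properties of an intertwiner on exterior powers of the standard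
   representation of a product of symmetric groups, one for each colour: [W] is the
   union of the sets on which these groups act, and [schur_sum] says that the values
   lie in the standard representation. *)
Record schur_class v : Prop := SchurClass {
  schur_altl : forall (r : 'S_k) X Y, v [ffun s => X (r s)] Y = (-1) ^+ r * v X Y;
  schur_altr : forall (r : 'S_k) X Y, v X [ffun s => Y (r s)] = (-1) ^+ r * v X Y;
  schur_swap : forall p q X Y, col p = col q ->
    v (swap_colours p q X) (swap_colours p q Y) = v X Y;
  schur_sum : forall X Y s,
    \sum_(p | col p == col (X s)) v (replace X s p) Y = 0 }.

Lemma schur_noninj v X Y (s t : 'I_k) : schur_class v ->
  s != t -> X s = X t -> v X Y = 0.
Proof.
move=> vS st Xst; have := schur_altl vS (tperm s t) X Y.
rewrite odd_tperm st /= expr1 mulN1r.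
have -> : [ffun u => X (tperm s t u)] = X.
  by apply/ffunP => u; rewrite ffunE; case: tpermP => [->|->|].
by move/eqP; rewrite -subr_eq0 opprK -mulr2n mulrn_eq0 => /eqP.
Qed.

(** Transposing the points [X s] and [X t] fixes [Y] and exchanges two positions of [X], so
    invariance and alternation give v X Y = - v X Y. *)
Lemma schur_two v X Y (s t : 'I_k) : schur_class v -> s != t ->
  col (X s) = col (X t) -> X s \notin codom Y -> X t \notin codom Y ->
  v X Y = 0.
Proof.
move=> vS st cst sY tY; have [Xst|Xst] := eqVneq (X s) (X t).
  exact: schur_noninj Xst.
have [/injectiveP XI|/injectivePn[a [b ab Xab]]] := boolP (injectiveb X); last first.
  exact: schur_noninj ab Xab.
have := schur_swap vS X Y cst.
have -> : swap_colours (X s) (X t) Y = Y.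
  apply/ffunP => u; rewrite ffunE tpermD //.
    by apply: contraNneq sY => ->; apply: codom_f.
  by apply: contraNneq tY => ->; apply: codom_f.
have -> : swap_colours (X s) (X t) X = [ffun u => X (tperm s t u)].
  by apply/ffunP => u; rewrite !ffunE inj_tperm.
rewrite schur_altl // odd_tperm st /= expr1 mulN1r => /eqP.
by rewrite eq_sym -subr_eq0 opprK -mulr2n mulrn_eq0 => /eqP.
Qed.

Lemma content_replace X s p : col p = col (X s) ->
  content (replace X s p) = content X.
Proof.
move=> cp; apply/ffunP => j; rewrite !ffunE; apply: eq_card => t.
by rewrite !inE ffunE; have [->|] := eqVneq t s; rewrite ?cp.
Qed.

Lemma content_swap p q X : col p = col q -> content (swap_colours p q X) = content X.
Proof.
move=> cp; apply/ffunP => j; rewrite !ffunE; apply: eq_card => t.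
by rewrite !inE ffunE; case: tpermP => [->|->|//]; rewrite cp.
Qed.

(* The zero-sum relation over the fibre of [X s] turns [v X Y] into a multiple of
   values at which [X s] has been moved into the image of [Y]. *)
Lemma schur_move v X Y (s : 'I_k) : schur_class v -> X s \notin codom Y ->
  (forall q, q \in codom Y -> q \notin codom X -> col q = col (X s) ->
     v (replace X s q) Y = 0) ->
  v X Y = 0.
Proof.
move=> vS sY vq.
have [/existsP[t /and3P[ts /eqP ct tY]]|] :=
  boolP [exists t, [&& t != s, col (X t) == col (X s) & X t \notin codom Y]].
  by apply: (schur_two vS ts).
move=> /existsPn noX; have := schur_sum vS X Y s.
(* [m] counts the [p] whose term equals [v X Y]: [X s] itself, and the points outside both images,
   reached by a swap that fixes [Y]. The other terms vanish, by a repetition in [X] or by [vq]. *)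
pose m := #|[pred p | (col p == col (X s)) && (p \notin codom Y) && 
  ((p == X s) || (p \notin codom X))]|.
suff -> : \sum_(p | col p == col (X s)) v (replace X s p) Y = v X Y *+ m.
  move/eqP; rewrite mulrn_eq0 => /orP[|/eqP//]; rewrite /m => /eqP m0.
  by have := card0_eq m0 (X s); rewrite !inE !eqxx sY.
rewrite -sumr_const /= big_mkcond [RHS]big_mkcond; apply: eq_bigr => p _ /=.
rewrite !inE; case: eqP => //= cp.
have [->|pXs] /= := eqVneq p (X s).
  rewrite sY; congr v; apply/ffunP => t; rewrite ffunE.
  by case: eqP => // ->.
have [/codomP[t pX]|pX] /= := boolP (p \in codom X).
  rewrite andbF; apply: (@schur_noninj _ _ _ s t) => //.
    by apply: contraNneq pXs => ->; rewrite pX.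
  by rewrite !ffunE eqxx; case: eqP.
rewrite andbT; have [pY|pY] /= := boolP (p \in codom Y); first exact: vq.
rewrite -(schur_swap vS X Y (esym cp)); congr v; apply/ffunP => t; rewrite !ffunE.
  have [->|ts] := eqVneq t s; first by rewrite tpermL.
  have [Xts|Xts] := eqVneq (X t) (X s); last first.
    by rewrite tpermD // 1?eq_sym //; apply: contraNneq pX => <-; apply: codom_f.
  by have := noX t; rewrite ts Xts eqxx sY.
rewrite tpermD //; first by apply: contraNneq sY => ->; apply: codom_f.
by apply: contraNneq pY => ->; apply: codom_f.
Qed.

Lemma codom_sub_perm X Y : injective X -> {subset codom X <= codom Y} ->
  exists r : 'S_k, X = [ffun s => Y (r s)].
Proof.
move=> XI XY.
pose f s := iinv (XY (X s) (codom_f X s)).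
have fE s : Y (f s) = X s by rewrite /f f_iinv.
have fI : injective f by move=> s t /(congr1 Y); rewrite !fE => /XI.
by exists (perm fI); apply/ffunP => s; rewrite ffunE permE fE.
Qed.

(** Induction on the number of entries of [X] outside the image of [Y]: [schur_move] brings one of
    them inside and keeps the content. When none is left, an injective [X] is a rearrangement of
    [Y]. *)
Lemma schur_vanish v X Y : schur_class v ->
  (content X = content Y -> v Y Y = 0) -> v X Y = 0.
Proof.
move=> vS; have [N leN] := ubnP #|[pred s | X s \notin codom Y]|.
elim: N => // N IH in X leN *.
move=> vYY.
have [/injectiveP XI|/injectivePn[a [b ab Xab]]] := boolP (injectiveb X); last first.
  exact: schur_noninj ab Xab.
have [/forallP XY|/forallPn[s sY]] := boolP [forall s, X s \in codom Y].
  have [|r XE] := codom_sub_perm XI (Y := Y).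
    by move=> _ /codomP[s ->]; apply: XY.
  have vY : v Y Y = 0.
    apply: vYY; apply/ffunP => j; rewrite !ffunE -!sum1_card.
    rewrite [RHS](reindex_inj (@perm_inj _ r)).
    by apply: eq_bigl => s; rewrite !inE XE ffunE.
  by rewrite XE schur_altl // vY mulr0.
apply: (schur_move vS sY) => q qY qX cq; apply: IH; last by rewrite content_replace.
rewrite -ltnS; apply: leq_trans leN; rewrite ltnS; apply: proper_card.
apply/properP; split; last first.
  by exists s; rewrite !inE // ffunE eqxx qY.
apply/fintype.subsetP => t; rewrite !inE ffunE; case: eqP => //.
by rewrite qY.
Qed.

(** Otherwise, within the colour of [Y s], the image of [X] would be strictly contained in that of
    [Y], although both have the same size. *)
Lemma content_exists X Y s : injective X -> injective Y -> content X = content Y ->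
  Y s \notin codom X -> exists2 t, X t \notin codom Y & col (X t) = col (Y s).
Proof.
move=> XI YI XY sX; apply/exists2P.
have [/existsP[t /andP[tY /eqP ct]]|/existsPn no] :=
  boolP [exists t, (X t \notin codom Y) && (col (X t) == col (Y s))].
  by exists t.
pose j := col (Y s).
have cE (Z : {ffun 'I_k -> W}) : injective Z ->
    content Z j = #|[pred p | (p \in codom Z) && (col p == j)]|.
  move=> ZI; rewrite ffunE.
  rewrite -(fintype.card_image ZI); apply: eq_card => p; rewrite !inE.
  apply/fintype.imageP/andP => [[t]|[/codomP[t ->] ct]]; last by exists t.
  by rewrite inE => ct ->; rewrite codom_f.
suff : (content X j < content Y j)%N by rewrite XY ltnn.
rewrite !cE //; apply: proper_card; apply/properP; split.
  apply/fintype.subsetP => p; rewrite !inE => /andP[/codomP[t ->] ct].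
  by rewrite ct andbT; have := no t; rewrite ct andbT negbK.
by exists (Y s); rewrite !inE ?codom_f //= (negPf sX).
Qed.

(** Transposing an entry of [Y] missing from [X] with one of [X] missing from [Y], in both arguments
    at once, keeps the value and brings [Y] closer to [X]. *)
Lemma schur_diag v X Y : schur_class v -> injective X ->
  content X = content Y -> v X X = 0 -> v Y Y = 0.
Proof.
move=> vS XI + vXX; have [N leN] := ubnP #|[pred s | Y s \notin codom X]|.
elim: N => // N IH in Y leN *.
move=> XY.
have [/injectiveP YI|/injectivePn[a [b ab Yab]]] := boolP (injectiveb Y); last first.
  exact: schur_noninj ab Yab.
have [/forallP YX|/forallPn[s sX]] := boolP [forall s, Y s \in codom X].
  have [|r YE] := codom_sub_perm YI (Y := X).
    by move=> _ /codomP[s ->]; apply: YX.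
  by rewrite YE schur_altl // schur_altr // vXX !mulr0.
have [t tY ct] := content_exists XI YI XY sX.
rewrite -(schur_swap vS Y Y (esym ct)); apply: IH; last by rewrite content_swap.
rewrite -ltnS; apply: leq_trans leN; rewrite ltnS; apply: proper_card.
apply/properP; split; last first.
  by exists s; rewrite !inE // ffunE tpermL codom_f.
apply/fintype.subsetP => u; rewrite !inE ffunE; case: tpermP => [_|Yu|//].
  by rewrite codom_f.
by rewrite -Yu codom_f in tY.
Qed.

Lemma schur_content v X Y : schur_class v -> content X != content Y -> v X Y = 0.
Proof. by move=> vS /eqP nXY; apply: schur_vanish. Qed.

(** Schur's lemma: the combination of [v] and [w] that vanishes at (Z, Z) is again in the class, and
    by [schur_diag] and [schur_vanish] it vanishes on the whole content. *)
Lemma schur_proportional v w X Y Z : schur_class v -> schur_class w ->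
  content Z = content X ->
  w Z Z * v X Y = v Z Z * w X Y.
Proof.
move=> vS wS ZX.
have [/injectiveP ZI|/injectivePn[a [b ab Zab]]] := boolP (injectiveb Z); last first.
  by rewrite !(schur_noninj _ _ ab Zab) // !mul0r.
have [XY|nXY] := eqVneq (content X) (content Y); last first.
  by rewrite (schur_content vS nXY) (schur_content wS nXY) !mulr0.
pose u X Y := w Z Z * v X Y - v Z Z * w X Y.
have uS : schur_class u.
  split=> [r X' Y'|r X' Y'|p q X' Y' cpq|X' Y' s]; rewrite /u.
  - by rewrite !schur_altl // mulrBr !(mulrCA _ (_ ^+ _)).
  - by rewrite !schur_altr // mulrBr !(mulrCA _ (_ ^+ _)).
  - by rewrite !schur_swap.
  - by rewrite sumrB -!mulr_sumr !schur_sum // !mulr0 subrr.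
suff /eqP : u X Y = 0 by rewrite subr_eq0 => /eqP.
apply: schur_vanish => // _; apply: (schur_diag uS ZI); first by rewrite ZX.
by rewrite /u mulrC subrr.
Qed.

End ColouredSchur.

(** * Second moment of the coefficients of the characteristic polynomial *)

Section SecondMoment.

Variables (R : realFieldType) (n d k : nat).
Hypothesis n_gt0 : (0 < n)%N.

Local Notation W := ('I_d * 'I_n)%type.
Local Notation G := {ffun 'I_d -> 'S_n}.
Local Notation tuples T := {ffun 'I_k -> T}.
Local Notation cont := (content (@fst 'I_d 'I_n)).

Definition centered (i j : 'I_n) : R := (i == j)%:R - n%:R^-1.

(** Block diagonal matrix B with blocks P_l (1 - J/n), where P_l is the permutation matrix of
    [g l]. *)
Definition block_centered (g : G) (p q : W) : R :=
  (p.1 == q.1)%:R * centered (g p.1 p.2) q.2.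

Definition sum_centered (g : G) (i j : 'I_n) : R := \sum_l centered (g l i) j.

Definition block_proj (p q : W) : R := (p.1 == q.1)%:R * centered p.2 q.2.

(** This is C^T C for the matrix C that forgets the colour of a point of [W]. *)
Definition same_row (p q : W) : R := (p.2 == q.2)%:R.

Let nR_neq0 : n%:R != 0 :> R. Proof. by rewrite pnatr_eq0 -lt0n. Qed.

Lemma centered_sym i j : centered i j = centered j i.
Proof. by rewrite /centered eq_sym. Qed.

Lemma sum_delta (T : finType) (i : T) (f : T -> R) :
  \sum_j (i == j)%:R * f j = f i.
Proof.
rewrite (bigD1 i) //= eqxx mul1r big1 ?addr0 // => j ji.
by rewrite eq_sym (negPf ji) mul0r.
Qed.

Lemma sum_centered0 i : \sum_j centered i j = 0.
Proof.
rewrite sumrB; under eq_bigr do rewrite -[_%:R]mulr1.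
by rewrite sum_delta sumr_const card_ord -[n%:R^-1]mulr1 -mulrnAr mulVf ?subrr.
Qed.

Lemma centered_idem i j : \sum_l centered i l * centered l j = centered i j.
Proof.
transitivity (\sum_l ((i == l)%:R * centered l j - n%:R^-1 * centered j l)).
  by apply: eq_bigr => l _; rewrite -[centered j l]centered_sym -mulrBl.
by rewrite sumrB sum_delta -mulr_sumr sum_centered0 mulr0 subr0.
Qed.

Lemma centered_perm (s : 'S_n) i j : centered (s i) (s j) = centered i j.
Proof. by rewrite /centered (inj_eq (@perm_inj _ s)). Qed.

Lemma sum_block (h : W -> R) (l : 'I_d) :
  \sum_q (l == q.1)%:R * h q = \sum_i h (l, i).
Proof.
transitivity (\sum_a \sum_b (l == a)%:R * h (a, b)).
  by rewrite pair_bigA; apply: eq_bigr => -[].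
by under eq_bigr do rewrite -mulr_sumr; rewrite sum_delta.
Qed.

(** Each block is a permutation matrix times a projection, so B^T B is the projection. *)
Lemma block_centered_mull g p q :
  \sum_r block_centered g r p * block_centered g r q = block_proj p q.
Proof.
under eq_bigr do rewrite /block_centered eq_sym -mulrA.
rewrite sum_block /= /block_proj.
under eq_bigr do rewrite mulrCA.
rewrite -mulr_sumr; congr (_ * _).
under eq_bigr do rewrite [X in X * _]centered_sym.
by rewrite -[RHS]centered_idem [RHS](reindex_inj (@perm_inj _ (g p.1))).
Qed.

Lemma block_proj_same_row p i :
  \sum_q block_proj p q * (q.2 == i)%:R = centered p.2 i.
Proof.
under eq_bigr do rewrite /block_proj -mulrA.
rewrite sum_block /=; under eq_bigr do rewrite mulrC eq_sym.
by rewrite sum_delta.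
Qed.

(** A nonzero term of the expansion matches entries of equal colour. *)
Lemma sub_det_content (a : W -> W -> R) (X Y : tuples W) :
  (forall p q, p.1 != q.1 -> a p q = 0) -> cont X != cont Y -> sub_det a X Y = 0.
Proof.
move=> a0 nXY; rewrite /sub_det /determinant big1 // => r _.
have [/forallP Xr|/forallPn[s Xs]] := boolP [forall s, (X s).1 == (Y (r s)).1].
  case/eqP: nXY; apply/ffunP => j; rewrite !ffunE -!sum1_card.
  rewrite [RHS](reindex_inj (@perm_inj _ r)).
  by apply: eq_bigl => s; rewrite !inE (eqP (Xr s)).
by rewrite (bigD1 s) //= mxE a0 // mul0r mulr0.
Qed.

Lemma sub_det_sum0 (S T : finType) (a : S -> T -> R) (P : pred S) (X : tuples S)
    (Y : tuples T) s :
  (forall t, \sum_(p | P p) a p (Y t) = 0) ->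
  \sum_(p | P p) sub_det a (replace X s p) Y = 0.
Proof.
move=> a0; rewrite exchange_big /= big1 // => r _.
rewrite -mulr_sumr (eq_bigr (fun p => a p (Y (r s)) *
  \prod_(t | t != s) a (X t) (Y (r t)))); last first.
  move=> p _; rewrite (bigD1 s) //= mxE ffunE eqxx; congr (_ * _).
  by apply: eq_bigr => t ts; rewrite mxE ffunE (negPf ts).
by rewrite -mulr_suml a0 mul0r mulr0.
Qed.

Lemma sub_det_swap (a b : W -> W -> R) (X Y : tuples W) p q :
  (forall u v, a (tperm p q u) v = b u v) ->
  sub_det a (swap_colours p q X) Y = sub_det b X Y.
Proof.
by move=> ab; congr determinant; apply/matrixP => s t; rewrite !mxE ffunE ab.
Qed.

Lemma tperm_same_colour (p q u : W) : p.1 = q.1 ->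
  tperm p q u = (u.1, if u.1 == p.1 then tperm p.2 q.2 u.2 else u.2).
Proof.
case: p q u => [a i] [b j] [c l] /= <-; rewrite /tperm /=.
rewrite !permE /= !xpair_eqE.
by case: (eqVneq c a) => [->|] //=; case: eqP => // _; case: eqP.
Qed.

Definition colour_tperm (p q : W) : G := [ffun l => if l == p.1 then tperm p.2 q.2 else 1%g].

Lemma block_centered_swap g p q u v : p.1 = q.1 ->
  block_centered g (tperm p q u) v =
  block_centered [ffun l => (colour_tperm p q l * g l)%g] u v.
Proof.
move=> pq; rewrite tperm_same_colour // /block_centered /= !ffunE permM.
by case: (u.1 == p.1); rewrite ?perm1.
Qed.

Lemma block_proj_swap p q u v : p.1 = q.1 ->
  block_proj (tperm p q u) (tperm p q v) = block_proj u v.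
Proof.
move=> pq; rewrite !tperm_same_colour // /block_proj /=.
case: (eqVneq u.1 v.1) => [->|_]; last by rewrite !mul0r.
by case: ifP => // _; rewrite centered_perm.
Qed.

Definition block_minor (g : G) (X Y : tuples W) : R := sub_det (block_centered g) X Y.

Definition proj_minor (X Y : tuples W) : R := sub_det block_proj X Y.

Definition minor_cov (X Y X' Y' : tuples W) : R :=
  \sum_(g : G) block_minor g X Y * block_minor g X' Y'.

Lemma block_centered_sum0 g (l : 'I_d) q :
  \sum_(p : W | p.1 == l) block_centered g p q = 0.
Proof.
rewrite big_mkcond /=.
transitivity (\sum_(p : W) (l == p.1)%:R * block_centered g p q).
  by apply: eq_bigr => p _; rewrite eq_sym; case: eqP; rewrite ?mul1r ?mul0r.
rewrite sum_block /block_centered /= -mulr_sumr.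
under eq_bigr do rewrite centered_sym.
rewrite (_ : \sum_i _ = 0) ?mulr0 // -[RHS](sum_centered0 q.2).
by rewrite [RHS](reindex_inj (@perm_inj _ (g l))).
Qed.

Lemma block_proj_sym p q : block_proj p q = block_proj q p.
Proof. by rewrite /block_proj eq_sym centered_sym. Qed.

Lemma proj_minor_sym X Y : proj_minor X Y = proj_minor Y X.
Proof. by rewrite /proj_minor sub_det_tr; apply: eq_sub_det => s t; rewrite block_proj_sym. Qed.

Lemma block_proj1 p q : block_proj p q = block_centered [ffun=> 1%g] p q.
Proof. by rewrite /block_proj /block_centered ffunE perm1. Qed.

(** Translating [g] by [colour_tperm] absorbs a swap of two points; the zero sums come from the
    centring of each block. *)
Lemma minor_cov_schur Y Y' : schur_class (@fst 'I_d 'I_n) (fun X X' => minor_cov X Y X' Y').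
Proof.
split=> [r X X'|r X X'|p q X X' pq|X X' s].
- rewrite mulr_sumr; apply: eq_bigr => g _.
  by rewrite /block_minor sub_det_perml mulrA.
- rewrite mulr_sumr; apply: eq_bigr => g _.
  by rewrite /block_minor sub_det_perml mulrCA.
- pose h (g : G) : G := [ffun l => (colour_tperm p q l * g l)%g].
  have hI : injective h.
    by move=> g g' /ffunP E; apply/ffunP => l; have := E l; rewrite !ffunE => /mulgI.
  rewrite /minor_cov [RHS](reindex_inj hI); apply: eq_bigr => g _.
  by congr (_ * _); apply: sub_det_swap => u v; apply: block_centered_swap.
- rewrite exchange_big big1 //= => g _; rewrite -mulr_suml sub_det_sum0 ?mul0r //.
  by move=> t; apply: block_centered_sum0.
Qed.

Lemma proj_minor_schur : schur_class (@fst 'I_d 'I_n) proj_minor.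
Proof.
split=> [r X X'|r X X'|p q X X' pq|X X' s].
- exact: sub_det_perml.
- exact: sub_det_permr.
- congr determinant; apply/matrixP => s t; rewrite !mxE !ffunE.
  exact: block_proj_swap.
- apply: sub_det_sum0 => t; under eq_bigr do rewrite block_proj1.
  exact: block_centered_sum0.
Qed.

Lemma block_minor_content g X Y : cont X != cont Y -> block_minor g X Y = 0.
Proof.
by apply: sub_det_content => p q /negPf pq; rewrite /block_centered pq mul0r.
Qed.

(** Trace of the projection onto the constituent labelled by the content of [X], hence k! times its
    dimension. *)
Definition content_trace (X : tuples W) : R :=
  \sum_(Z | cont Z == cont X) proj_minor Z Z.

(** By Cauchy-Binet and the identity for B^T B, every [g] contributes the same amount. *)
Lemma sum_minor_cov Y Y' :
  \sum_Z minor_cov Z Y Z Y' = #|G|%:R * k`!%:R * proj_minor Y Y'.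
Proof.
rewrite exchange_big /=.
rewrite (eq_bigr (fun=> k`!%:R * proj_minor Y Y')).
  by rewrite sumr_const -[RHS]mulrA [RHS]mulr_natl.
move=> g _; rewrite /block_minor.
under eq_bigr do rewrite sub_det_tr.
rewrite cauchy_binet; congr (_ * _).
by apply: eq_sub_det => s t; rewrite block_centered_mull.
Qed.

(* Schur orthogonality for the exterior powers of the standard representation; the
   constant is found by contracting [X] with [X']. *)
Lemma minor_covE X Y X' Y' : cont X = cont Y ->
  content_trace X * minor_cov X Y X' Y' =
  #|G|%:R * k`!%:R * (proj_minor X X' * proj_minor Y Y').
Proof.
move=> XY; rewrite [RHS]mulrCA -sum_minor_cov [RHS]mulr_sumr.
rewrite /content_trace [LHS]mulr_suml big_mkcond; apply: eq_bigr => Z _; case: eqP => [ZX|/eqP ZX].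
  have /= -> := schur_proportional X' (minor_cov_schur Y Y') proj_minor_schur ZX.
  exact: mulrC.
rewrite XY in ZX.
by rewrite /minor_cov big1 ?mulr0 // => g _; rewrite block_minor_content ?mul0r.
Qed.

(** The matrix is 1 - E E^T / n for the incidence matrix E of [f], and E^T E is the diagonal matrix
    of fibre sizes. *)
Lemma det_rank_one_sum m (f : 'I_k -> 'I_m) :
  \det (\matrix_(s < k, t < k) ((s == t)%:R - (f s == f t)%:R / n%:R)) =
  \prod_(l < m) (1 - #|[pred s | f s == l]|%:R / n%:R) :> R.
Proof.
pose E : 'M[R]_(k, m) := \matrix_(s, l) (f s == l)%:R.
transitivity (\det (1%:M + (- n%:R^-1 *: E) *m E^T)).
  congr determinant; apply/matrixP => s t; rewrite -scalemxAl !mxE.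
  under [X in _ = _ + _ * X]eq_bigr do rewrite !mxE.
  by rewrite sum_delta mulNr mulrC [f t == _]eq_sym.
rewrite det_add_mulC -scalemxAr.
have -> : 1%:M + - n%:R^-1 *: (E^T *m E) =
    diag_mx (\row_l (1 - #|[pred s | f s == l]|%:R / n%:R)).
  apply/matrixP => l l'; rewrite !mxE.
  under eq_bigr do rewrite !mxE.
  have [<-|ll'] := eqVneq l l'; last first.
    rewrite big1 ?mulr0 ?addr0 // => s _; case: eqP => [->|]; rewrite ?mul0r //.
    by rewrite (negPf ll') mulr0.
  under eq_bigr do rewrite mulr_natl mulrb.
  rewrite mulr1n -sum1_card natr_sum mulNr mulrC big_mkcond /=.
  by congr (1 - _ / _); rewrite [RHS]big_mkcond; apply: eq_bigr => s _; rewrite inE; case: eqP.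
by rewrite det_diag; apply: eq_bigr => l _; rewrite mxE.
Qed.

Definition row_minor (x y : tuples 'I_n) : R := sub_det centered x y.

Definition zip_tuple (c : tuples 'I_d) (x : tuples 'I_n) : tuples W :=
  [ffun s => (c s, x s)].

Lemma proj_minor_diag (X : tuples W) : injective X ->
  proj_minor X X = \prod_(l < d) (1 - #|[pred s | (X s).1 == l]|%:R / n%:R).
Proof.
move=> XI; rewrite -det_rank_one_sum; congr determinant.
apply/matrixP => s t; rewrite !mxE /block_proj /centered mulrBr.
congr (_ - _); rewrite -natrM mulnb; congr (_%:R).
by rewrite -xpair_eqE -!surjective_pairing (inj_eq XI).
Qed.

Lemma row_minor_diag (x : tuples 'I_n) : injective x ->
  row_minor x x = 1 - k%:R / n%:R.
Proof.
move=> xI; have := det_rank_one_sum (fun _ : 'I_k => ord0 : 'I_1).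
rewrite big_ord1 (eq_card (B := 'I_k)); last by move=> s; rewrite !inE.
rewrite card_ord => <-; congr determinant; apply/matrixP => s t; rewrite !mxE.
by rewrite /centered (inj_eq xI) eqxx mul1r.
Qed.

Lemma bernoulli_prod (I : finType) (a : I -> R) :
  (forall i, 0 <= a i <= 1) ->
  0 <= \prod_i (1 - a i) /\ 1 - \sum_i a i <= \prod_i (1 - a i).
Proof.
(* The upper bound by 1 is added so that two such inequalities can be multiplied. *)
move=> a01; suff [] : 0 <= \prod_i (1 - a i) <= 1 /\ 1 - \sum_i a i <= \prod_i (1 - a i).
  by case/andP.
elim/big_ind2: _ => [|x1 x2 y1 y2 [/andP[? ?] ?] [/andP[? ?] ?]|i _].
- by rewrite subr0 lexx ler01.
- by split; [apply/andP; split|]; nra.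
- by have /andP[? ?] := a01 i; split; [apply/andP; split|]; lra.
Qed.

Lemma card_colour_le (X : tuples W) l : injective X -> (#|[pred s | (X s).1 == l]| <= n)%N.
Proof.
move=> XI; rewrite -[X in (_ <= X)%N]card_ord.
apply: (@leq_card_in _ _ (fun s => (X s).2)) => s t; rewrite !inE => /eqP s1 /eqP t1 st.
by apply: XI; rewrite (surjective_pairing (X s)) (surjective_pairing (X t)) s1 t1 st.
Qed.

Lemma proj_minor_ge0 X : 0 <= proj_minor X X.
Proof.
have [/injectiveP XI|/injectivePn[s [t st Xst]]] := boolP (injectiveb X); last first.
  by rewrite /proj_minor (sub_det_noninj _ _ st Xst).
rewrite proj_minor_diag //; apply: prodr_ge0 => l _.
by rewrite subr_ge0 ler_pdivrMr ?ltr0n // mul1r ler_nat card_colour_le.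
Qed.

(* Hence the weights in [sum_minors_sqE] are at most [1]. *)
Lemma row_minor_le (c : tuples 'I_d) (x : tuples 'I_n) :
  row_minor x x <= proj_minor (zip_tuple c x) (zip_tuple c x).
Proof.
have [/injectiveP xI|/injectivePn[s [t st xst]]] := boolP (injectiveb x); last first.
  by rewrite {1}/row_minor (sub_det_noninj _ _ st xst) proj_minor_ge0.
have XI : injective (zip_tuple c x) by move=> s t; rewrite !ffunE => -[_ /xI].
rewrite row_minor_diag // proj_minor_diag //.
pose a l : R := #|[pred s | (zip_tuple c x s).1 == l]|%:R / n%:R.
have [|_] := @bernoulli_prod 'I_d a.
  move=> l; rewrite divr_ge0 ?ler0n //= ler_pdivrMr ?ltr0n // mul1r ler_nat.
  exact: card_colour_le.
apply: le_trans; rewrite -mulr_suml -natr_sum.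
suff -> : (\sum_(l < d) #|[pred s | (zip_tuple c x s).1 == l]|)%N = k by [].
rewrite -[RHS]card_ord -sum1_card (partition_big c predT) //=.
by apply: eq_bigr => l _; rewrite -sum1_card; apply: eq_bigl => s; rewrite !inE ffunE.
Qed.

Lemma sum_zip_tuple (V : nmodType) (h : tuples W -> V) :
  \sum_X h X = \sum_c \sum_x h (zip_tuple c x).
Proof.
rewrite pair_bigA (reindex (fun p => zip_tuple p.1 p.2)) //=.
exists (fun X : tuples W => ([ffun s => (X s).1], [ffun s => (X s).2])) => /= [[c x] _|X _].
  by congr (_, _); apply/ffunP => s; rewrite !ffunE.
by apply/ffunP => s; rewrite !ffunE -surjective_pairing.
Qed.

Lemma content_zip_tuple c x : cont (zip_tuple c x) = content id c.
Proof. by apply/ffunP => l; rewrite !ffunE; apply: eq_card => s; rewrite !inE ffunE. Qed.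

(** The case of a zero constituent, where [minor_covE] gives no information. A zero trace of
    nonnegative terms forces [proj_minor Y Y] to vanish, hence by [sum_minor_cov] a sum of squares
    in which every [block_minor g X Y] occurs. *)
Lemma content_trace_eq0 X Y X' Y' : cont X = cont Y -> content_trace X = 0 ->
  minor_cov X Y X' Y' = 0.
Proof.
move=> XY T0; rewrite /minor_cov big1 // => g _.
have Y0 : proj_minor Y Y = 0.
  apply/eqP; move/eqP: T0; rewrite psumr_eq0 => [/allP /(_ Y)|Z _]; last exact: proj_minor_ge0.
  by rewrite mem_index_enum XY eqxx => /(_ isT).
have /eqP := sum_minor_cov Y Y; rewrite Y0 mulr0 psumr_eq0 => [/allP /(_ X)|Z _]; last first.
  by apply: sumr_ge0 => h _; rewrite -expr2 sqr_ge0.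
rewrite mem_index_enum => /(_ isT) /=; rewrite psumr_eq0 => [/allP /(_ g)|h _]; last first.
  by rewrite -expr2 sqr_ge0.
by rewrite mem_index_enum => /(_ isT) /=; rewrite mulf_eq0 orbb => /eqP ->; rewrite mul0r.
Qed.

Lemma minor_cov_proj X Y X' Y' :
  minor_cov X Y X' Y' = (cont X == cont Y)%:R *
    ((content_trace X)^-1 * (#|G|%:R * k`!%:R) * (proj_minor X X' * proj_minor Y Y')).
Proof.
have [XY|XY] := eqVneq; last first.
  by rewrite mul0r /minor_cov big1 // => g _; rewrite block_minor_content ?mul0r.
rewrite mul1r; have [T0|T0] := eqVneq (content_trace X) 0.
  by rewrite content_trace_eq0 // T0 invr0 !mul0r.
by rewrite -[RHS]mulrA -minor_covE // mulKf.
Qed.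

Lemma sum_centered_block g i j :
  sum_centered g i j = \sum_(p : W) (i == p.2)%:R *
    \sum_q block_centered g p q * (q.2 == j)%:R.
Proof.
transitivity (\sum_(l < d) \sum_(i' < n) (i == i')%:R * centered (g l i') j).
  by apply: eq_bigr => l _; rewrite sum_delta.
rewrite pair_bigA; apply: eq_bigr => -[l i'] _ /=; congr (_ * _).
under eq_bigr do rewrite /block_centered -mulrA.
rewrite sum_block /=; under eq_bigr do rewrite mulrC eq_sym.
by rewrite sum_delta.
Qed.

(** The centred sum is C B C^T, with C forgetting colours. Traces of exterior powers are cyclic, so
    B gets paired with C^T C, which is [same_row]. *)
Lemma sum_minors_block g :
  k`!%:R * \sum_(x : tuples 'I_n) sub_det (sum_centered g) x x =
  \sum_(X : tuples W) \sum_(Y : tuples W) block_minor g X Y * sub_det same_row Y X.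
Proof.
have kf : k`!%:R != 0 :> R by rewrite pnatr_eq0 -lt0n fact_gt0.
apply: (mulfI kf); rewrite !mulr_sumr.
transitivity (\sum_(x : tuples 'I_n) \sum_(X : tuples W) \sum_(Y : tuples W)
    sub_det (fun i (p : W) => (i == p.2)%:R) x X *
    (block_minor g X Y * sub_det (fun (q : W) j => (q.2 == j)%:R) Y x)).
  apply: eq_bigr => x _.
  transitivity (k`!%:R * (\sum_(X : tuples W) sub_det (fun i (p : W) => (i == p.2)%:R) x X *
      sub_det (fun p j => \sum_q block_centered g p q * (q.2 == j)%:R) X x)).
    rewrite cauchy_binet; congr (_ * (_ * _)).
    by apply: eq_sub_det => s t; rewrite sum_centered_block.
  rewrite mulr_sumr; apply: eq_bigr => X _.
  by rewrite mulrCA -mulr_sumr cauchy_binet.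
rewrite exchange_big; apply: eq_bigr => X _; rewrite exchange_big mulr_sumr.
apply: eq_bigr => Y _.
under eq_bigr do rewrite mulrCA [sub_det _ _ X * _]mulrC.
rewrite -mulr_sumr cauchy_binet mulrCA; congr (_ * (_ * _)).
by apply: eq_sub_det => s t; under eq_bigr do rewrite mulrC eq_sym mulrC; rewrite sum_delta eq_sym.
Qed.

(** Two Cauchy-Binet contractions, each costing k!: between two block projections, [same_row]
    becomes the projection on rows, blind to colours. *)
Lemma proj_minor_same_row X Y :
  \sum_(X' : tuples W) \sum_(Y' : tuples W)
    sub_det same_row Y' X' * (proj_minor X X' * proj_minor Y Y') =
  k`!%:R ^+ 2 * sub_det (fun p q => centered p.2 q.2) X Y.
Proof.
transitivity (\sum_(X' : tuples W) proj_minor X X' *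
    (k`!%:R * sub_det (fun p q => centered p.2 q.2) X' Y)).
  apply: eq_bigr => X' _.
  transitivity (proj_minor X X' * \sum_(Y' : tuples W) sub_det same_row X' Y' * proj_minor Y' Y).
    rewrite mulr_sumr; apply: eq_bigr => Y' _.
    rewrite mulrCA [proj_minor Y Y']proj_minor_sym sub_det_tr; congr (_ * (_ * _)).
    by apply: eq_sub_det => s t; rewrite /same_row eq_sym.
  congr (_ * _); rewrite cauchy_binet; congr (_ * _).
  apply: eq_sub_det => s t; rewrite /same_row centered_sym -block_proj_same_row.
  by apply: eq_bigr => q _; rewrite mulrC block_proj_sym eq_sym.
under eq_bigr do rewrite mulrCA.
rewrite -mulr_sumr cauchy_binet mulrA -expr2; congr (_ * _).
apply: eq_sub_det => s t.
under eq_bigr do rewrite /block_proj -mulrA.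
by rewrite sum_block /= centered_idem.
Qed.


Definition colour_trace (c : tuples 'I_d) : R :=
  \sum_(c' : tuples 'I_d | content id c' == content id c)
     \sum_(x : tuples 'I_n) proj_minor (zip_tuple c' x) (zip_tuple c' x).

Lemma content_trace_zip c x : content_trace (zip_tuple c x) = colour_trace c.
Proof.
rewrite /content_trace big_mkcond sum_zip_tuple /colour_trace [RHS]big_mkcond.
apply: eq_bigr => c' _; rewrite -big_mkcond /= content_zip_tuple.
under eq_bigl do rewrite content_zip_tuple.
by case: ifP => // _; rewrite big_pred0.
Qed.

(** Expanding the square leaves covariances, evaluated by [minor_cov_proj]; contraction then
    separates colours from rows. The sum over [x] is the falling factorial (n-1)_k, and
    [colour_trace c] is the number of colourings with the content of [c] times the product of the
    (n-1)_(k_j). *)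
Lemma sum_minors_sqE :
  \sum_(g : G) (\sum_(x : tuples 'I_n) sub_det (sum_centered g) x x) ^+ 2 =
  k`!%:R ^+ 2 * #|G|%:R * \sum_(c : tuples 'I_d)
    \sum_(c' : tuples 'I_d | content id c == content id c')
      (colour_trace c)^-1 * \sum_x row_minor x x.
Proof.
have kf : k`!%:R != 0 :> R by rewrite pnatr_eq0 -lt0n fact_gt0.
apply: (mulfI (expf_neq0 2 kf)).
transitivity (\sum_(g : G) (\sum_(p : tuples W * tuples W)
    block_minor g p.1 p.2 * sub_det same_row p.2 p.1) ^+ 2).
  rewrite mulr_sumr; apply: eq_bigr => g _.
  by rewrite -exprMn sum_minors_block pair_bigA.
transitivity (\sum_(p : tuples W * tuples W) \sum_(q : tuples W * tuples W)
   sub_det same_row p.2 p.1 * (sub_det same_row q.2 q.1 * minor_cov p.1 p.2 q.1 q.2)).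
  under eq_bigr do rewrite expr2 mulr_suml.
  rewrite exchange_big; apply: eq_bigr => p _.
  under eq_bigr do rewrite mulr_sumr.
  rewrite exchange_big; apply: eq_bigr => q _ /=.
  by rewrite /minor_cov !mulr_sumr; apply: eq_bigr => g _; ring.
transitivity (\sum_(X : tuples W) \sum_(Y : tuples W) sub_det same_row Y X *
    ((cont X == cont Y)%:R * ((content_trace X)^-1 * (#|G|%:R * k`!%:R)) *
     (k`!%:R ^+ 2 * sub_det (fun p q : W => centered p.2 q.2) X Y))).
  rewrite [RHS]pair_bigA; apply: eq_bigr => -[X Y] _ /=.
  rewrite -mulr_sumr; congr (_ * _).
  rewrite -proj_minor_same_row pair_bigA [RHS]mulr_sumr.
  by apply: eq_bigr => -[X' Y'] _ /=; rewrite minor_cov_proj; ring.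
rewrite sum_zip_tuple.
rewrite mulrA mulr_sumr; apply: eq_bigr => c _.
transitivity (\sum_(c' : tuples 'I_d) (content id c == content id c')%:R *
    (k`!%:R ^+ 2 * (k`!%:R ^+ 2 * #|G|%:R) * ((colour_trace c)^-1 *
     \sum_x row_minor x x))); last first.
  rewrite [RHS]mulr_sumr [RHS]big_mkcond; apply: eq_bigr => c' _.
  by case: eqP => _; rewrite ?mul1r ?mul0r.
under eq_bigr do rewrite sum_zip_tuple.
rewrite exchange_big; apply: eq_bigr => c' _.
set B := (content id c == content id c')%:R.
transitivity (\sum_x B * ((colour_trace c)^-1 * (#|G|%:R * k`!%:R)) *
    k`!%:R ^+ 2 * (k`!%:R * row_minor x x)); last first.
  by rewrite -mulr_sumr -mulr_sumr; ring.
apply: eq_bigr => x _; rewrite content_trace_zip content_zip_tuple.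
transitivity (B * ((colour_trace c)^-1 * (#|G|%:R * k`!%:R)) * k`!%:R ^+ 2 *
    \sum_(y : tuples 'I_n) row_minor x y * sub_det (fun i j => (i == j)%:R) y x).
  rewrite mulr_sumr; apply: eq_bigr => y _; rewrite content_zip_tuple -/B.
  have -> : sub_det same_row (zip_tuple c' y) (zip_tuple c x) =
      sub_det (fun i j => (i == j)%:R) y x.
    by congr determinant; apply/matrixP => s t; rewrite !mxE !ffunE.
  have -> : sub_det (fun p q : W => centered p.2 q.2) (zip_tuple c x) (zip_tuple c' y) =
      row_minor x y.
    by congr determinant; apply/matrixP => s t; rewrite !mxE !ffunE.
  ring.
rewrite cauchy_binet; congr (_ * (_ * _)); apply: eq_sub_det => s t.
by under eq_bigr do rewrite eq_sym mulrC; rewrite sum_delta.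
Qed.

(** By [row_minor_le], the number of colourings with the content of [c], times the row sum, is at
    most [colour_trace c]; so each of the d^k colourings contributes at most 1. *)
Lemma sum_minors_second_moment :
  \sum_(g : G) (\sum_(x : tuples 'I_n) sub_det (sum_centered g) x x) ^+ 2 <=
  k`!%:R ^+ 2 * (d ^ k)%:R * #|G|%:R.
Proof.
rewrite sum_minors_sqE [leRHS]mulrAC ler_wpM2l // ?mulr_ge0 ?exprn_ge0 ?ler0n //.
have -> : (d ^ k)%:R = \sum_(c : tuples 'I_d) 1 :> R.
  by rewrite sumr_const card_ffun !card_ord.
apply: ler_sum => c _; rewrite sumr_const -mulr_natl mulrCA.
set S := \sum_x _.
have ST : #|[pred c' : tuples 'I_d | content id c == content id c']|%:R * S <= colour_trace c.
  rewrite mulr_natl -sumr_const /colour_trace big_mkcond [leRHS]big_mkcond /=.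
  apply: ler_sum => c' _; rewrite inE [content id c' == _]eq_sym; case: ifP => // _.
  by apply: ler_sum => x _; apply: row_minor_le.
have [T0|T0] := eqVneq (colour_trace c) 0; first by rewrite T0 invr0 mul0r ler01.
rewrite mulrC ler_pdivrMr ?mul1r //.
rewrite lt_def T0 /=; apply: sumr_ge0 => c' _; apply: sumr_ge0 => x _; exact: proj_minor_ge0.
Qed.

End SecondMoment.

(** * Zero-free discs from power sums *)

Section TruncatedExponential.

Variable C : numFieldType.
Implicit Types (l : seq C) (p q : {poly C}) (K : nat).

Definition recip_poly l : {poly C} := \prod_(a <- l) (1 - a%:P * 'X).

Definition power_sum l k : C := \sum_(a <- l) a ^+ k.

(** For the power sums of [l], the truncation of - log of [recip_poly l]. *)
Definition log_poly (t : nat -> C) K : {poly C} :=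
  \sum_(k < K) (t k.+1 / k.+1%:R)%:P * 'X^(k.+1).

Definition trunc_exp K (x : C) : C := \sum_(j < K.+1) j`!%:R^-1 * x ^+ j.

Definition trunc_exp_poly K p : {poly C} := \sum_(j < K.+1) (j`!%:R^-1)%:P * p ^+ j.

Lemma deriv_trunc_exp K p :
  (trunc_exp_poly K p)^`() =
  p^`() * (trunc_exp_poly K p - (K`!%:R^-1)%:P * p ^+ K).
Proof.
rewrite /trunc_exp_poly big_ord_recr /= addrK.
elim: K => [|K IH].
  by rewrite !big_ord0 add0r fact0 invr1 expr0 mulr1 derivC mulr0.
have E : ((K.+1)`!%:R^-1)%:P * (K.+1)%:R = (K`!%:R^-1)%:P :> {poly C}.
  rewrite -polyC_natr -polyCM factS natrM invfM mulrAC mulVf ?mul1r // pnatr_eq0.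
rewrite big_ord_recr /= derivD IH mulrDr; congr (_ + _).
rewrite derivM derivC mul0r add0r deriv_exp /=.
by rewrite -E; ring.
Qed.

Lemma deriv_log_poly t K :
  (log_poly t K)^`() = \sum_(k < K) (t k.+1)%:P * 'X^k.
Proof.
rewrite raddf_sum; apply: eq_bigr => k _.
rewrite /= derivM derivC mul0r add0r derivXn.
have E : (t k.+1 / k.+1%:R)%:P * (k.+1)%:R = (t k.+1)%:P :> {poly C}.
  by rewrite -polyC_natr -polyCM divfK ?pnatr_eq0.
by rewrite -E /=; ring.
Qed.

(** Newton's identities as a logarithmic derivative modulo ['X^K]; each factor 1 - a z enters
    through its geometric series. *)
Lemma newton_recip_poly l K : exists q,
  (recip_poly l)^`() + (\sum_(k < K) (power_sum l k.+1)%:P * 'X^k) * recip_poly l = 'X^K * q.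
Proof.
elim: l => [|a l [q IH]].
  exists 0; rewrite /recip_poly big_nil -polyC1 derivC add0r mulr0 mulr1.
  by apply: big1 => k _; rewrite /power_sum big_nil mul0r.
exists ((1 - a%:P * 'X) * q - (a ^+ K.+1)%:P * recip_poly l).
have -> : recip_poly (a :: l) = (1 - a%:P * 'X) * recip_poly l.
  by rewrite /recip_poly big_cons.
have -> : \sum_(k < K) (power_sum (a :: l) k.+1)%:P * 'X^k =
    \sum_(k < K) (a ^+ k.+1)%:P * 'X^k + \sum_(k < K) (power_sum l k.+1)%:P * 'X^k.
  rewrite -big_split /=; apply: eq_bigr => k _.
  by rewrite /power_sum big_cons polyCD mulrDl.
have geo : (\sum_(k < K) (a ^+ k.+1)%:P * 'X^k) * (1 - a%:P * 'X) =
    a%:P - (a ^+ K.+1)%:P * 'X^K.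
  elim: (K) => [|k IHk]; first by rewrite big_ord0 mul0r expr1 expr0 mulr1 subrr.
  by rewrite big_ord_recr /= mulrDl IHk (exprSr a k.+1) polyCM (exprS 'X k); ring.
rewrite derivM derivB -polyC1 derivC derivM derivC derivX polyC1.
move: IH geo; set s := \sum_(k < K) _; set f := recip_poly l.
set sa := \sum_(k < K) _ => IH geo.
transitivity ((1 - a%:P * 'X) * ('X^K * q) - (a ^+ K.+1)%:P * 'X^K * f); last by ring.
rewrite -IH.
transitivity ((1 - a%:P * 'X) * (f^`() + s * f) + f * (sa * (1 - a%:P * 'X) - a%:P)).
  by ring.
by rewrite geo; ring.
Qed.

(** The derivative of [g] is divisible by ['X^K]: so is the error in Newton's identities, and so is
    the top term lost when differentiating the truncated exponential, since its argument has no
    constant term. *)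
Lemma coef_recip_trunc_exp l K :
  let g := recip_poly l * trunc_exp_poly K (log_poly (power_sum l) K) in
  g`_0 = 1 /\ forall m, (0 < m <= K)%N -> g`_m = 0.
Proof.
move=> g; set T := log_poly (power_sum l) K.
have [T1 TX] : exists T1, T = 'X * T1.
  exists (\sum_(k < K) (power_sum l k.+1 / k.+1%:R)%:P * 'X^k).
  by rewrite mulr_sumr; apply: eq_bigr => k _; rewrite exprS mulrCA.
split.
  rewrite -horner_coef0 hornerM horner_prod /trunc_exp_poly horner_sum big1_seq; last first.
    by move=> a _; rewrite !(hornerE, mulr0, subr0).
  rewrite mul1r -/T big_ord_recl big1 /= ?addr0 => [|j _]; first by rewrite !hornerE fact0 invr1.
  by rewrite hornerM horner_exp TX hornerM hornerX mul0r expr0n mulr0.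
have [q Nq] := newton_recip_poly l K.
have dg : g^`() = 'X^K * (q * trunc_exp_poly K T -
    recip_poly l * T^`() * (K`!%:R^-1)%:P * T1 ^+ K).
  have TK : T ^+ K = 'X^K * T1 ^+ K by rewrite TX exprMn.
  rewrite derivM deriv_trunc_exp -/T TK.
  rewrite -deriv_log_poly -/T in Nq.
  transitivity ('X^K * q * trunc_exp_poly K T -
    recip_poly l * T^`() * (K`!%:R^-1)%:P * ('X^K * T1 ^+ K)); last by ring.
  by rewrite -Nq; ring.
case=> // m /andP[_ mK]; have := coef_deriv g m; rewrite dg coefXnM mK.
by move/esym/eqP; rewrite mulrn_eq0 => /eqP.
Qed.

(** Stable under sums and products, so the coefficients of [g] below are controlled by evaluating a
    nonnegative polynomial at [rho]. *)
Definition majorant p q : Prop := forall i, `|p`_i| <= q`_i.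

Definition abs_poly p : {poly C} := \poly_(i < size p) `|p`_i|.

Lemma coef_abs_poly p i : (abs_poly p)`_i = `|p`_i|.
Proof. by rewrite coef_poly; case: ltnP => // ip; rewrite nth_default ?normr0. Qed.

Lemma majorant_abs p : majorant p (abs_poly p).
Proof. by move=> i; rewrite coef_abs_poly. Qed.

Lemma majorantM p q p' q' :
  majorant p p' -> majorant q q' -> majorant (p * q) (p' * q').
Proof.
move=> pp qq i; rewrite !coefM; apply: (le_trans (ler_norm_sum _ _ _)).
by apply: ler_sum => j _; rewrite normrM ler_pM.
Qed.

Lemma majorant_sum (I : Type) (r : seq I) (F F' : I -> {poly C}) :
  (forall i, majorant (F i) (F' i)) -> majorant (\sum_(i <- r) F i) (\sum_(i <- r) F' i).
Proof.
move=> FF i; rewrite !coef_sum; apply: (le_trans (ler_norm_sum _ _ _)).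
by apply: ler_sum => j _; apply: FF.
Qed.

Lemma majorantC (c : C) : 0 <= c -> majorant c%:P c%:P.
Proof. by move=> c0 i; rewrite coefC; case: ifP; rewrite ?normr0 // ger0_norm. Qed.

Lemma majorantX p q j : majorant p q -> majorant (p ^+ j) (q ^+ j).
Proof.
move=> pq; elim: j => [|j IH]; last by rewrite !exprS; apply: majorantM.
by rewrite !expr0 -polyC1; apply: majorantC; exact: ler01.
Qed.

Lemma majorant_trunc_exp K p q :
  majorant p q -> majorant (trunc_exp_poly K p) (trunc_exp_poly K q).
Proof.
move=> pq; apply: majorant_sum => j; apply: majorantM; last exact: majorantX.
by apply: majorantC; rewrite invr_ge0 ler0n.
Qed.

(* Multiplying the polynomial by the truncated exponential of its truncated logarithm
   kills the coefficients of degree [1] to [K]; what is left is small inside the disc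
   of radius [r < rho]. *)
Lemma root_recip_poly_bound l K (z r rho : C) :
  root (recip_poly l) z -> `|z| <= r -> 0 <= r -> r <= rho -> 0 < rho ->
  1 <= (r / rho) ^+ K.+1 * ((abs_poly (recip_poly l)).[rho] *
    trunc_exp K (\sum_(k < K) `|power_sum l k.+1| / k.+1%:R * rho ^+ k.+1)).
Proof.
move=> /rootP fz zr r0 rrho rho0.
set f := recip_poly l in fz *; set T := log_poly (power_sum l) K.
pose T' := log_poly (fun k => `|power_sum l k|) K.
pose g := f * trunc_exp_poly K T; pose q := abs_poly f * trunc_exp_poly K T'.
have gq : majorant g q.
  apply: majorantM; [exact: majorant_abs|apply: majorant_trunc_exp].
  apply: majorant_sum => k i; rewrite !coefCM !coefXn.
  by rewrite !normrM normfV !normr_nat.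
have <- : q.[rho] = (abs_poly f).[rho] *
    trunc_exp K (\sum_(k < K) `|power_sum l k.+1| / k.+1%:R * rho ^+ k.+1).
  rewrite hornerM; congr (_ * _); rewrite horner_sum; apply: eq_bigr => j _.
  rewrite hornerM hornerC horner_exp; congr (_ * _ ^+ _).
  by rewrite horner_sum; apply: eq_bigr => k _; rewrite hornerM hornerC hornerXn.
have [g0 gK] := coef_recip_trunc_exp l K.
have gz : g.[z] = 0 by rewrite hornerM fz mul0r.
pose N := maxn (size g) (size q).
have gN : (size g <= N.+1)%N by rewrite ltnW // ltnS leq_maxl.
have qN : (size q <= N.+1)%N by rewrite ltnW // ltnS leq_maxr.
(* As [g] has constant term 1 and vanishes at [z], its remaining terms add up to -1, and those of
   degree at most [K] are absent. *)
move: gz; rewrite (horner_coef_wide z gN) big_ord_recl g0 mul1r expr0.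
rewrite addrC => /eqP; rewrite addr_eq0 => /eqP S1.
have q_ge0 i : 0 <= q`_i by apply: le_trans (gq i).
have rr0 : 0 <= r / rho by rewrite divr_ge0 // ltW.
rewrite -[leLHS]normr1 -normrN -S1 (le_trans (ler_norm_sum _ _ _)) //.
rewrite (horner_coef_wide rho qN) big_ord_recl mulrDr mulr_sumr ler_wpDl //.
  by rewrite !mulr_ge0 ?exprn_ge0 // ltW.
apply: ler_sum => i _; rewrite lift0 normrM normrX.
have [iK|iK] := leqP i.+1 K.
  by rewrite gK // normr0 mul0r !mulr_ge0 ?exprn_ge0 // ltW.
rewrite mulrCA ler_pM ?exprn_ge0 //.
apply: (@le_trans _ _ (r ^+ i.+1)); first by rewrite lerXn2r ?nnegrE.
rewrite -[leLHS](@divfK _ (rho ^+ i.+1)) ?expf_neq0 ?gt_eqF // -expr_div_n.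
rewrite ler_wpM2r ?exprn_ge0 ?(ltW rho0) // ler_wiXn2l //.
by rewrite ler_pdivrMr // mul1r.
Qed.

End TruncatedExponential.

(** * Partial information on random permutations *)

Lemma set_U1_ind (T : finType) (Q : {set T} -> Prop) :
  Q finset.set0 -> (forall q (D : {set T}), q \notin D -> Q D -> Q (q |: D)) ->
  forall D, Q D.
Proof.
move=> Q0 QS D; have [N leN] := ubnP #|D|; elim: N => // N IH in D leN *.
have [->//|[q qD]] := set_0Vmem D; rewrite -(finset.setD1K qD).
apply: QS; first by rewrite !inE eqxx.
by apply: IH; rewrite (cardsD1 q D) qD in leN.
Qed.

Section Queries.

Variables (n d : nat).
Local Notation W := ('I_d * 'I_n)%type.
Local Notation G := {ffun 'I_d -> 'S_n}.
Implicit Types (D : {set W}) (y : W -> 'I_n) (g : G) (q : W).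

Definition answers D y g := [forall q in D, g q.1 q.2 == y q].

(* Switching with [redirect] trades the answer to one query for another one; this
   compares the numbers of families with [#|D|] and [#|D| + 1] prescribed answers. *)
Definition redirect q (i j : 'I_n) g : G :=
  [ffun l => if l == q.1 then (g l * tperm i j)%g else g l].

Lemma redirectK q i j : involutive (redirect q i j).
Proof.
move=> g; apply/ffunP => l; rewrite !ffunE; case: eqP => // _.
by rewrite -mulgA tperm2 mulg1.
Qed.

Lemma redirect_head q i j g : redirect q i j g q.1 q.2 = tperm i j (g q.1 q.2).
Proof. by rewrite ffunE eqxx permM. Qed.

(** Only the answers of the colour of [q] change. None of them equals [j] by hypothesis, and none
    equals the old answer at [q] by injectivity of the permutation. *)
Lemma redirect_answers D y q j g : q \notin D -> answers D y g ->
  (forall q', q' \in D -> q'.1 = q.1 -> y q' != j) ->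
  answers D y (redirect q (g q.1 q.2) j g).
Proof.
move=> qD /forall_inP gD yj; apply/forall_inP => q' q'D; rewrite ffunE.
have [qq|_] := eqVneq q'.1 q.1; last exact: gD.
rewrite permM (eqP (gD _ q'D)) tpermD //; last by rewrite eq_sym; apply: yj.
rewrite -(eqP (gD _ q'D)) qq (inj_eq (@perm_inj _ _)).
apply: contraNneq qD => q2; suff -> : q = q' by [].
by rewrite (surjective_pairing q) (surjective_pairing q') q2 qq.
Qed.

Lemma answersU1 D y q g : answers (q |: D) y g = (g q.1 q.2 == y q) && answers D y g.
Proof.
apply/forall_inP/andP => [gD|[gq /forall_inP gD] q' /setU1P[->//|/gD//]].
split; first by apply: gD; rewrite setU11.
by apply/forall_inP => q' q'D; apply: gD; rewrite setU1r.
Qed.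

(** Redirect [q] to any of the at least n - #|D| values not prescribed on [D]. The new answer at [q]
    reveals the chosen value, so this is injective. *)
Lemma card_answersU1_le D y q : q \notin D ->
  (#|[set g | answers (q |: D) y g]| * (n - #|D|) <= #|[set g | answers D y g]|)%N.
Proof.
move=> qD; pose B := (~: [set y q' | q' in D])%SET.
have leB : (n - #|D| <= #|B|)%N.
  rewrite (cardsCs B) finset.setCK card_ord; apply: leq_sub2l.
  exact: leq_imset_card.
apply: (@leq_trans #|finset.setX [set g | answers (q |: D) y g] B|).
  by rewrite cardsX leq_mul2l leB orbT.
pose h (p : G * 'I_n) := redirect q (y q) p.2 p.1.
rewrite -(card_in_imset (f := h)); last first.
  move=> [g i] [g' i']; rewrite !inE !answersU1 /=.
  move=> /andP[/andP[/eqP gq _] _] /andP[/andP[/eqP gq' _] _] E.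
  have ii : i = i'.
    have := congr1 (fun f : G => f q.1 q.2) E.
    by rewrite /h !redirect_head /= gq gq' !tpermL.
  by move: E; rewrite /h -ii /= => /(can_inj (@redirectK _ _ _)) ->.
apply: subset_leq_card; apply/fintype.subsetP => _ /imsetP[[g i] + ->].
rewrite !inE answersU1 /= => /andP[/andP[/eqP gq gD] iD].
rewrite /h /= -gq; apply: redirect_answers => // q' q'D _.
by apply: contraNneq iD => <-; apply: imset_f.
Qed.

(** The reverse switching: redirect [q] to [y q] and record its old answer, one of [n] values. *)
Lemma card_answersU1_ge D y q : q \notin D ->
  (forall q', q' \in D -> q'.1 = q.1 -> y q' != y q) ->
  (#|[set g | answers D y g]| <= n * #|[set g | answers (q |: D) y g]|)%N.
Proof.
move=> qD yq; pose h (g : G) := (redirect q (g q.1 q.2) (y q) g, g q.1 q.2).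
have -> : (n * #|[set g | answers (q |: D) y g]| =
    #|finset.setX [set g | answers (q |: D) y g] (finset.setTfor 'I_n)|)%N.
  by rewrite cardsX cardsT card_ord mulnC.
rewrite -(card_in_imset (f := h)); last first.
  by move=> g g' _ _ [] + E; rewrite E => /(can_inj (@redirectK _ _ _)).
apply: subset_leq_card; apply/fintype.subsetP => _ /imsetP[g + ->].
rewrite !inE /h /= andbT answersU1 redirect_head tpermL eqxx /= => gD.
exact: redirect_answers.
Qed.

Lemma card_answers_le D y m : (#|D| <= m)%N ->
  (#|[set g | answers D y g]| * (n - m) ^ #|D| <= #|G|)%N.
Proof.
elim/set_U1_ind: D => [|q D qD IH]; first by rewrite cards0 expn0 muln1 max_card.
rewrite cardsU1 qD add1n => Dm; apply: leq_trans (IH (ltnW Dm)).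
rewrite expnS mulnA leq_mul2r; apply/orP; right.
apply: leq_trans (card_answersU1_le y qD); rewrite leq_mul2l; apply/orP; right.
by apply: leq_sub2l; apply: ltnW.
Qed.

Lemma card_answers_ge D y :
  (forall q q', q \in D -> q' \in D -> q.1 = q'.1 -> y q = y q' -> q = q') ->
  (#|G| <= n ^ #|D| * #|[set g | answers D y g]|)%N.
Proof.
elim/set_U1_ind: D => [|q D qD IH] yI.
  rewrite cards0 mul1n; apply: subset_leq_card; apply/fintype.subsetP => g _.
  by rewrite inE; apply/forall_inP => q; rewrite inE.
rewrite cardsU1 qD add1n expnSr -mulnA; apply: leq_trans (IH _) _.
  by move=> p p' pD p'D; apply: yI; rewrite inE ?pD ?p'D orbT.
rewrite leq_mul2l; apply/orP; right; apply: card_answersU1_ge => // q' q'D q1.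
apply: contraNneq qD => yq; suff <- : q' = q by [].
by apply: yI => //; rewrite !inE ?eqxx ?q'D ?orbT.
Qed.

End Queries.

(** * Closed walks *)

Section Walks.

Variables (R : realFieldType) (n d : nat).
Hypothesis n_gt0 : (0 < n)%N.
Local Notation W := ('I_d * 'I_n)%type.
Local Notation G := {ffun 'I_d -> 'S_n}.

Section AnyShape.

Variables (I : finType) (nu : I -> I).
Implicit Types (e : {ffun I -> W}) (g : G).

(** [e s] is the colour and the vertex at position [s], and [nu] gives the next position. Leaving
    [nu] arbitrary covers one cyclic walk as well as a pair of them. *)
Definition closed_walk g e := [forall s, g (e s).1 (e s).2 == (e (nu s)).2].

Definition walk_sites e : {set W} := [set e s | s : I].

Definition walk_vertices e : {set 'I_n} := [set (e s).2 | s : I].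

Definition walk_prob e : R := #|[set g | closed_walk g e]|%:R / #|G|%:R.

(** If some [g0] follows [e], all families following [e] agree with [g0] on the sites, and the query
    bound applies. *)
Lemma card_closed_walk_le e :
  (#|[set g | closed_walk g e]| * (n - #|I|) ^ #|walk_sites e| <= #|G|)%N.
Proof.
have [->|[g0]] := set_0Vmem [set g | closed_walk g e]; first by rewrite cards0.
rewrite inE => /forallP e0.
pose y (q : W) : 'I_n := g0 q.1 q.2.
apply: leq_trans (card_answers_le y (leq_imset_card e I : #|walk_sites e| <= _)%N).
rewrite leq_mul2r; apply/orP; right; apply: subset_leq_card.
apply/fintype.subsetP => g; rewrite !inE => /forallP ge.
apply/forall_inP => _ /imsetP[s _ ->]; rewrite /y.
by rewrite (eqP (ge s)) (eqP (e0 s)).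
Qed.

(** Distinct vertices make the required answers well defined, and distinct since [nu] is injective.
    The value of [y] off the walk is arbitrary. *)
Lemma card_closed_walk_ge e : injective nu -> injective (fun s => (e s).2) ->
  (#|G| <= n ^ #|I| * #|[set g | closed_walk g e]|)%N.
Proof.
move=> nuI eI.
pose y (q : W) : 'I_n := if [pick s | (e s).2 == q.2] is Some s then (e (nu s)).2 else q.2.
have yE s : y (e s) = (e (nu s)).2.
  rewrite /y; case: pickP => [t /eqP /eI ->//|/(_ s)].
  by rewrite eqxx.
have -> : #|I| = #|walk_sites e|.
  by rewrite /walk_sites card_imset // => s t /(congr1 snd) /eI.
apply: leq_trans (_ : _ <= n ^ #|walk_sites e| * #|[set g | answers (walk_sites e) y g]|)%N _.
  apply: card_answers_ge => _ _ /imsetP[s _ ->] /imsetP[t _ ->] _.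
  by rewrite !yE => /eI /nuI ->.
rewrite leq_mul2l; apply/orP; right; apply: subset_leq_card.
apply/fintype.subsetP => g; rewrite !inE => /forall_inP ge.
by apply/forallP => s; rewrite -yE; apply: ge; apply: imset_f.
Qed.

Lemma walk_vertices_le e : (#|walk_vertices e| <= #|walk_sites e|)%N.
Proof.
rewrite (_ : walk_vertices e = [set q.2 | q in walk_sites e]%SET) ?leq_imset_card //.
by rewrite /walk_sites -imset_comp.
Qed.

Lemma walk_sites_le e : (#|walk_sites e| <= #|I|)%N.
Proof. exact: leq_imset_card. Qed.

Lemma bernoulli_expr (x : R) k : 0 <= x <= 1 -> 1 - k%:R * x <= (1 - x) ^+ k.
Proof.
move=> /andP[x0 x1]; elim: k => [|k IH]; first by rewrite mul0r subr0 expr0.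
rewrite exprS -[k.+1]addn1 natrD.
have k0 : 0 <= k%:R :> R by rewrite ler0n.
have : 0 <= (1 - x) * ((1 - x) ^+ k - (1 - k%:R * x)).
  by rewrite mulr_ge0 // subr_ge0.
nra.
Qed.

Lemma card_G_gt0 : 0 < #|G|%:R :> R.
Proof. by rewrite ltr0n; apply/card_gt0P; exists [ffun=> 1%g]. Qed.

Lemma walk_prob_ge0 e : 0 <= walk_prob e.
Proof. by rewrite divr_ge0 ?ler0n. Qed.

Hypothesis n_large : (2 * #|I| ^ 2 <= n)%N.

(** With x = m^2 / n, Bernoulli gives (n - m)^E >= n^E (1 - x) because E <= m; [n_large] means x <=
    1/2, whence 1 / (1 - x) <= 1 + 2 x. *)
Lemma walk_prob_le e :
  walk_prob e <= (1 + 2 * #|I|%:R ^+ 2 / n%:R) * n%:R ^- #|walk_sites e|.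
Proof.
have nR : 0 < n%:R :> R by rewrite ltr0n.
set m : R := #|I|%:R; set E := #|walk_sites e|.
pose x := m ^+ 2 / n%:R.
have x2 : 2 * x <= 1.
  by rewrite mulrA ler_pdivrMr // mul1r -natrX -natrM ler_nat.
have x0 : 0 <= x by rewrite divr_ge0 ?exprn_ge0 ?ler0n.
have mn : (#|I| <= n)%N.
  by apply: leq_trans n_large; case: #|I| => // k; rewrite mulnCA; nia.
have cE : walk_prob e * (n%:R ^+ E * (1 - x)) <= 1.
  rewrite /walk_prob mulrAC ler_pdivrMr ?card_G_gt0 // mul1r.
  apply: le_trans (_ : #|[set g | closed_walk g e]|%:R * (n - #|I|)%:R ^+ E <= _); last first.
    by rewrite -natrX -natrM ler_nat card_closed_walk_le.
  rewrite ler_wpM2l ?ler0n //.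
  have -> : (n - #|I|)%:R = n%:R * (1 - m / n%:R) :> R.
    by rewrite mulrBr mulr1 mulrCA divff ?gt_eqF // mulr1 natrB.
  rewrite exprMn ler_wpM2l ?exprn_ge0 ?ler0n //.
  apply: le_trans (bernoulli_expr E _); last first.
    by rewrite divr_ge0 ?ler0n //= ler_pdivrMr // mul1r ler_nat.
  rewrite lerD2l lerN2 mulrA ler_wpM2r ?invr_ge0 ?ler0n // expr2 ler_wpM2r ?ler0n //.
  by rewrite ler_nat walk_sites_le.
rewrite -[2 * _ / _]mulrA -/x ler_pdivlMr ?exprn_gt0 //.
have P0 := walk_prob_ge0 e; have E0 : 0 <= n%:R ^+ E :> R by rewrite exprn_ge0 ?ler0n.
have : 0 <= walk_prob e * n%:R ^+ E by rewrite mulr_ge0.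
move: cE; rewrite mulrA; set p := _ * _ ^+ E => cE p0.
have : 0 <= (1 - p * (1 - x)) * (1 + 2 * x) by rewrite mulr_ge0 ?subr_ge0 //; lra.
have : 0 <= p * (x * (1 - 2 * x)) by rewrite !mulr_ge0 // subr_ge0.
nra.
Qed.

Lemma walk_prob_le2 e : walk_prob e <= 2 * n%:R ^- #|walk_sites e|.
Proof.
apply: le_trans (walk_prob_le e) _; rewrite ler_wpM2r ?invr_ge0 ?exprn_ge0 ?ler0n //.
suff : 2 * #|I|%:R ^+ 2 / n%:R <= 1 :> R by lra.
by rewrite ler_pdivrMr ?ltr0n // mul1r -natrX -natrM ler_nat.
Qed.

(** A walk is encoded by its colours, a list of [q] vertices and the index in this list at each
    position. *)
Lemma card_walk_vertices q :
  (#|[set e | #|walk_vertices e| == q]| <= d ^ #|I| * n ^ q * q ^ #|I|)%N.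
Proof.
pose h (p : {ffun I -> 'I_d} * {ffun 'I_q -> 'I_n} * {ffun I -> 'I_q}) : {ffun I -> W} :=
  [ffun s => (p.1.1 s, p.1.2 (p.2 s))].
have <- : #|{: {ffun I -> 'I_d} * {ffun 'I_q -> 'I_n} * {ffun I -> 'I_q}}| =
    (d ^ #|I| * n ^ q * q ^ #|I|)%N by rewrite !card_prod !card_ffun !card_ord.
apply: leq_trans (leq_imset_card h _); apply: subset_leq_card.
apply/fintype.subsetP => e; rewrite inE => /eqP Vq; apply/imsetP.
have eV s : (e s).2 \in walk_vertices e by apply: imset_f.
exists ([ffun s => (e s).1], [ffun i => enum_val (cast_ord (esym Vq) i)],
   [ffun s => cast_ord Vq (enum_rank_in (eV s) (e s).2)]) => //.
apply/ffunP => s; rewrite !ffunE /= cast_ordK enum_rankK_in //.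
exact: surjective_pairing.
Qed.

(* A walk visiting [V] vertices through [E > V] edges has probability about [n ^- E],
   while there are only [O(n ^ V)] of them. *)
Lemma sum_walk_prob_excess :
  \sum_(e | (#|walk_vertices e| < #|walk_sites e|)%N) walk_prob e <=
  2 * (#|I|.+1 * d ^ #|I| * #|I| ^ #|I|)%:R / n%:R.
Proof.
have nR : 0 < n%:R :> R by rewrite ltr0n.
apply: le_trans (_ : \sum_e 2 / n%:R * n%:R ^- #|walk_vertices e| <= _).
  rewrite big_mkcond; apply: ler_sum => e _; case: ifP => [VE|_]; last first.
    by rewrite !mulr_ge0 ?invr_ge0 ?exprn_ge0 ?ler0n.
  apply: le_trans (walk_prob_le2 e) _.
  rewrite -mulrA ler_wpM2l // -invfM -exprS lef_pV2 ?posrE ?exprn_gt0 //.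
  by rewrite ler_weXn2l // ler1n.
rewrite -mulr_sumr [leRHS]mulrAC ler_wpM2l ?divr_ge0 ?ler0n //.
rewrite (partition_big (fun e => inord #|walk_vertices e| : 'I_#|I|.+1) predT) //=.
apply: le_trans (_ : \sum_(q < #|I|.+1) (d ^ #|I| * #|I| ^ #|I|)%:R <= _); last first.
  by rewrite sumr_const card_ord -mulrnA mulnC mulnA.
apply: ler_sum => q _.
apply: le_trans (_ : \sum_(e | #|walk_vertices e| == q) n%:R ^- q <= _).
  rewrite le_eqVlt; apply/orP; left; apply/eqP; apply: eq_big => [e|e /eqP <-].
    rewrite -val_eqE /= inordK // ltnS.
    exact: leq_trans (walk_vertices_le e) (walk_sites_le e).
  rewrite inordK // ltnS.
  exact: leq_trans (walk_vertices_le e) (walk_sites_le e).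
rewrite sumr_const -[leLHS]mulr_natl ler_pdivrMr ?exprn_gt0 // -natrX -natrM ler_nat.
rewrite (eq_card (B := [set e | #|walk_vertices e| == q])); last by move=> e; rewrite inE.
apply: leq_trans (card_walk_vertices q) _.
rewrite mulnAC leq_mul2r; apply/orP; right; rewrite leq_mul2l; apply/orP; right.
have := ltn_ord q; rewrite ltnS; move: (nat_of_ord q) => j; move: #|I| => [|m] //.
by rewrite leq_exp2r.
Qed.

(* When [E = V] the walk follows the orbits of a partial function. *)
Lemma excess_or_tree_like g e : closed_walk g e ->
  ~~ (#|walk_vertices e| < #|walk_sites e|)%N ->
  forall s t, (e s).2 = (e t).2 ->
    e s = e t /\ forall i, e (iter i nu s) = e (iter i nu t).
Proof.
move=> /forallP ge; rewrite -leqNgt => EV.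
have sndI : {in walk_sites e &, injective snd}.
  apply/imset_injP; rewrite eqn_leq leq_imset_card /=.
  by rewrite /walk_sites -imset_comp.
have eE s t : (e s).2 = (e t).2 -> e s = e t by apply: sndI; apply: imset_f.
move=> s t est; split; first exact: eE.
elim=> [|i IH] /=; first exact: eE.
by apply: eE; rewrite -(eqP (ge _)) -(eqP (ge _)) IH.
Qed.

End AnyShape.

End Walks.

(** * Moments of the number of cyclic walks *)

Section CyclicWalks.

Variables (R : realFieldType) (n d k : nat).
Hypotheses (n_gt0 : (0 < n)%N) (d_gt0 : (0 < d)%N) (k_gt0 : (0 < k)%N).
Local Notation W := ('I_d * 'I_n)%type.
Local Notation G := {ffun 'I_d -> 'S_n}.
Local Notation walk := {ffun 'I_k -> W}.
Implicit Types (e : walk) (g : G).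

Let s0 := Ordinal k_gt0.

Definition simple_walk e := injectiveb (fun s => (e s).2).

Definition shift_walk (a : nat) e : walk := [ffun s => e (iter a (@ordS k) s)].

Lemma val_iter_ordS a (s : 'I_k) : iter a (@ordS k) s = ((s + a) %% k)%N :> nat.
Proof.
elim: a => [|a IH] /=; first by rewrite addn0 modn_small.
by rewrite IH -addn1 modnDml -addnA addn1.
Qed.

Lemma iter_ordS_from0 (s : 'I_k) : iter s (@ordS k) s0 = s.
Proof. by apply/val_inj; rewrite /= val_iter_ordS add0n modn_small. Qed.

Lemma iter_ordSk (s : 'I_k) : iter k (@ordS k) s = s.
Proof. by apply/val_inj; rewrite /= val_iter_ordS modnDr modn_small. Qed.

Lemma ordS_shift (s t : 'I_k) : iter (t + (k - s)) (@ordS k) s = t.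
Proof.
apply/val_inj; rewrite /= val_iter_ordS addnCA subnKC 1?ltnW //.
by rewrite modnDr modn_small.
Qed.

Lemma iter_ordS_mod a (s : 'I_k) : iter (a %% k) (@ordS k) s = iter a (@ordS k) s.
Proof. by apply/val_inj; rewrite /= !val_iter_ordS modnDmr. Qed.

Lemma shift_walkE a e s : shift_walk a e = e -> e (iter a (@ordS k) s) = e s.
Proof. by move=> /ffunP /(_ s); rewrite ffunE. Qed.

(** A walk of period [a] is determined by its first [a] steps. *)
Lemma card_shift_walk a : (0 < a)%N ->
  (#|[set e | shift_walk a e == e]| <= #|{: W}| ^ a)%N.
Proof.
move=> a0; pose h e : {ffun 'I_a -> W} := [ffun i : 'I_a => e (iter i (@ordS k) s0)].
rewrite -[X in (_ <= _ ^ X)%N]card_ord -card_ffun -(card_in_imset (f := h)) ?max_card //.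
move=> e e'; rewrite !inE => /eqP pe /eqP pe' /ffunP hh; apply/ffunP => s.
have red f : shift_walk a f = f -> f s = f (iter (s %% a) (@ordS k) s0).
  move=> pf; rewrite -{1}(iter_ordS_from0 s) {1}(divn_eq s a) addnC iterD.
  elim: (s %/ a)%N => [|j IH]; first by rewrite mul0n.
  rewrite mulSn iterD -IH -iterD addnC iterD.
  by rewrite shift_walkE // IH.
rewrite red // [RHS]red //.
by have := hh (Ordinal (ltn_pmod s a0)); rewrite !ffunE.
Qed.

Lemma shift_walk_of_eq e s a :
  (forall i, e (iter i (@ordS k) s) = e (iter i (@ordS k) (iter a (@ordS k) s))) ->
  shift_walk a e = e.
Proof.
move=> est; apply/ffunP => x; rewrite ffunE -(ordS_shift s x).
by rewrite -iterD addnC iterD -est.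
Qed.

(** A repeated vertex has the same future at both visits, which gives a period. If [a] is the least
    one, k - a is also a period, so a <= k/2, and minimality makes the first [a] sites distinct. The
    index in the statement is a - 1. *)
Lemma short_period e g : closed_walk (@ordS k) g e -> ~~ simple_walk e ->
  ~~ (#|walk_vertices e| < #|walk_sites e|)%N ->
  exists a : 'I_(k./2), shift_walk a.+1 e = e /\ (a < #|walk_sites e|)%N.
Proof.
move=> ge /injectivePn[s [t st est]] EV.
have tl := excess_or_tree_like ge EV.
have per_eq (x y : 'I_k) : x != y -> (e x).2 = (e y).2 ->
    exists a, (0 < a < k)%N /\ shift_walk a e = e.
  move=> xy exy; exists ((y + (k - x)) %% k)%N.
  have [_ exy'] := tl _ _ exy.
  have pa : shift_walk (y + (k - x)) e = e.
    by apply: (@shift_walk_of_eq _ x) => i; rewrite ordS_shift.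
  split.
    rewrite ltn_pmod // andbT lt0n; apply: contraNneq xy => a0.
    have := ordS_shift x y; rewrite -iter_ordS_mod a0 /= => ->.
    by [].
  by rewrite -[RHS]pa; apply/ffunP => z; rewrite !ffunE iter_ordS_mod.
have [a0 [/andP[a0_gt0 a0k] pa0]] := per_eq _ _ st est.
pose Q a := (0 < a)%N && (shift_walk a e == e).
have exQ : exists a, Q a by exists a0; rewrite /Q a0_gt0 pa0 eqxx.
case: (ex_minnP exQ) => a /andP[a_gt0 /eqP pa] amin.
have ak : (a < k)%N by apply: leq_ltn_trans a0k; apply: amin; rewrite /Q a0_gt0 pa0 eqxx.
have a2 : (a <= k - a)%N.
  apply: amin; rewrite /Q subn_gt0 ak /=; apply/eqP/ffunP => x; rewrite ffunE.
  by rewrite -(shift_walkE (iter (k - a) _ x) pa) -iterD subnKC ?iter_ordSk // ltnW.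
have ak2 : (a.-1 < k./2)%N by rewrite prednK // -divn2 leq_divRL // muln2 -addnn -leq_subRL // ltnW.
exists (Ordinal ak2); rewrite /= prednK //; split=> //.
rewrite -[leqLHS]card_ord.
have vI : injective (fun i : 'I_a => e (iter i (@ordS k) s0)).
  suff H (i j : 'I_a) : (i < j)%N -> e (iter i (@ordS k) s0) <> e (iter j (@ordS k) s0).
    by move=> i j eij; apply/val_inj; case: (ltngtP i j) => // /H; rewrite eij.
  move=> ij eij.
  have ik : (i < k)%N by apply: ltn_trans ak.
  have jk : (j < k)%N by apply: ltn_trans ak.
  have [_ E] := tl _ _ (congr1 snd eij).
  suff /amin : Q (j - i)%N by rewrite leqNgt (leq_ltn_trans (leq_subr _ _) (ltn_ord j)).
  rewrite /Q subn_gt0 ij /=; apply/eqP.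
  apply: (@shift_walk_of_eq _ (iter i (@ordS k) s0)) => l.
  by rewrite -[iter (j - i) _ _]iterD subnK // ltnW.
rewrite -(card_imset _ vI); apply: subset_leq_card.
by apply/fintype.subsetP => _ /imsetP[i _ ->]; apply: imset_f.
Qed.

Definition walk_count g := #|[set e | closed_walk (@ordS k) g e]|.

Definition simple_walk_count g :=
  #|[set e | closed_walk (@ordS k) g e && simple_walk e]|.

Definition avg (F : G -> R) : R := (\sum_g F g) / #|G|%:R.

Lemma avg_le F F' : (forall g, F g <= F' g) -> avg F <= avg F'.
Proof.
by move=> FF; rewrite ler_wpM2r ?invr_ge0 ?ler0n //; apply: ler_sum.
Qed.

Lemma avgD F F' : avg (fun g => F g + F' g) = avg F + avg F'.
Proof. by rewrite /avg big_split mulrDl. Qed.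

Lemma avgZ c F : avg (fun g => c * F g) = c * avg F.
Proof. by rewrite /avg -mulr_sumr mulrA. Qed.

Lemma avgC c : avg (fun=> c) = c.
Proof. by rewrite /avg sumr_const -[_ *+ _]mulr_natr mulfK // gt_eqF // card_G_gt0. Qed.

Lemma avg_count (T : finType) (P : pred T) (Q : T -> G -> bool) :
  avg (fun g => #|[set e | Q e g && P e]|%:R) =
  \sum_(e | P e) #|[set g | Q e g]|%:R / #|G|%:R.
Proof.
rewrite -mulr_suml; congr (_ / _).
under eq_bigr do rewrite -sum1_card natr_sum big_mkcond /=.
rewrite exchange_big [RHS]big_mkcond /=; apply: eq_bigr => e _.
case: ifP => Pe.
  rewrite -sum1_card natr_sum [RHS]big_mkcond; apply: eq_bigr => g _.
  by rewrite !inE Pe andbT.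
by apply: big1 => g _; rewrite !inE Pe andbF.
Qed.

Lemma sum_excess_le (I : finType) (nu : I -> I) (P : pred {ffun I -> W}) :
  (2 * #|I| ^ 2 <= n)%N ->
  \sum_(e | P e && (#|walk_vertices e| < #|walk_sites e|)%N) walk_prob R nu e <=
  2 * (#|I|.+1 * d ^ #|I| * #|I| ^ #|I|)%:R / n%:R.
Proof.
move=> nI; apply: le_trans (sum_walk_prob_excess R d n_gt0 nu nI).
rewrite big_mkcond [leRHS]big_mkcond; apply: ler_sum => e _.
by case: (P e) => //=; case: ifP => // _; apply: walk_prob_ge0.
Qed.

Lemma card_sites : #|{: W}| = (d * n)%N.
Proof. by rewrite card_prod !card_ord. Qed.

(** Walks with excess cost O(1/n). The others have a period a <= k/2 and at least [a] sites: there
    are at most (d n)^a of them, each of probability at most 2 n^-a, and summing 2 d^a over at most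
    k/2 periods gives k d^(k/2). *)
Lemma non_simple_walks : (2 * k ^ 2 <= n)%N ->
  \sum_(e | ~~ simple_walk e) walk_prob R (@ordS k) e <=
  2 * (k.+1 * d ^ k * k ^ k)%:R / n%:R + k%:R * d%:R ^+ k./2.
Proof.
move=> nk; have nR : 0 < n%:R :> R by rewrite ltr0n.
rewrite (bigID (fun e => #|walk_vertices e| < #|walk_sites e|)%N) /=; apply: lerD.
  by have := @sum_excess_le _ (@ordS k) (fun e => ~~ simple_walk e); rewrite card_ord; apply.
apply: (@le_trans _ _ (\sum_(a < k./2) \sum_(e | shift_walk a.+1 e == e) 2 * n%:R ^- a.+1)).
  rewrite [leRHS](exchange_big_dep predT) //= big_mkcond; apply: ler_sum => e _.
  have S0 : 0 <= \sum_(a < k./2 | shift_walk a.+1 e == e) 2 * n%:R ^- a.+1 :> R.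
    by apply: sumr_ge0 => a _; rewrite mulr_ge0 // invr_ge0 exprn_ge0 // ltW.
  case: ifP => // /andP[sw EV].
  have [E0|[g]] := set_0Vmem [set g : G | closed_walk (@ordS k) g e].
    by rewrite /walk_prob E0 cards0 mul0r.
  rewrite inE => ge; have [a [pa aE]] := short_period ge sw EV.
  rewrite (bigD1 a) ?pa //= ler_wpDr //.
    by apply: sumr_ge0 => b _; rewrite mulr_ge0 // invr_ge0 exprn_ge0 // ltW.
  have nk' : (2 * #|'I_k| ^ 2 <= n)%N by rewrite card_ord.
  apply: (le_trans (walk_prob_le2 R n_gt0 (@ordS k) nk' e)).
  rewrite ler_wpM2l // lef_pV2 ?posrE ?exprn_gt0 //.
  by rewrite ler_weXn2l // ler1n.
apply: (@le_trans _ _ (\sum_(a < k./2) 2 * d%:R ^+ k./2)).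
  apply: ler_sum => a _; rewrite sumr_const -[leLHS]mulr_natl mulrCA ler_wpM2l //.
  rewrite ler_pdivrMr ?exprn_gt0 //.
  apply: (@le_trans _ _ ((d * n)%:R ^+ a.+1)).
    by rewrite -natrX ler_nat; have := card_shift_walk (ltn0Sn a); rewrite card_sites cardsE.
  rewrite natrM exprMn ler_wpM2r ?exprn_ge0 ?ler0n //.
  by rewrite ler_weXn2l // ?ler1n.
rewrite sumr_const card_ord -[leLHS]mulr_natl mulrA ler_wpM2r ?exprn_ge0 ?ler0n //.
by rewrite -natrM ler_nat muln2 -[leqRHS]odd_double_half leq_addl.
Qed.

Local Notation pos2 := ('I_k + 'I_k)%type.

Definition ordS2 (x : pos2) : pos2 :=
  match x with inl s => inl (ordS s) | inr s => inr (ordS s) end.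

Definition join_walks e e' : {ffun pos2 -> W} :=
  [ffun x => match x with inl s => e s | inr s => e' s end].

Lemma join_walksl e e' s : join_walks e e' (inl s) = e s.
Proof. by rewrite ffunE. Qed.

Lemma join_walksr e e' s : join_walks e e' (inr s) = e' s.
Proof. by rewrite ffunE. Qed.

Lemma iter_ordS2l a s : iter a ordS2 (inl s) = inl (iter a (@ordS k) s).
Proof. by elim: a => //= a ->. Qed.

Lemma iter_ordS2r a s : iter a ordS2 (inr s) = inr (iter a (@ordS k) s).
Proof. by elim: a => //= a ->. Qed.

Lemma closed_join_walks g e e' : closed_walk ordS2 g (join_walks e e') =
  closed_walk (@ordS k) g e && closed_walk (@ordS k) g e'.
Proof.
apply/forallP/andP => [H|[/forallP H /forallP H'] [s|s]]; last first.
- by rewrite /= !join_walksr.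
- by rewrite /= !join_walksl.
split; apply/forallP => s.
  by have := H (inl s); rewrite /= !join_walksl.
by have := H (inr s); rewrite /= !join_walksr.
Qed.

(** From a common vertex on, both walks follow the same orbit. *)
Lemma shift_of_intersecting g e e' s t : closed_walk ordS2 g (join_walks e e') ->
  ~~ (#|walk_vertices (join_walks e e')| < #|walk_sites (join_walks e e')|)%N ->
  (e s).2 = (e' t).2 -> exists a : 'I_k, e' = shift_walk a e.
Proof.
move=> ge EV est; have tl := excess_or_tree_like ge EV.
have := tl (inl s) (inr t); rewrite join_walksl join_walksr => /(_ est) [_ E].
exists (Ordinal (ltn_pmod (s + (k - t)) k_gt0)); apply/ffunP => x; rewrite ffunE /=.
rewrite iter_ordS_mod -{1}(ordS_shift t x).
have := E (x + (k - t))%N; rewrite iter_ordS2l iter_ordS2r join_walksl join_walksr => <-.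
congr (e _); apply/val_inj; rewrite /= !val_iter_ordS; congr (_ %% _)%N.
by rewrite addnCA.
Qed.

Lemma join_walks_bij (V : nmodType) (h : {ffun pos2 -> W} -> V) :
  \sum_c h c = \sum_e \sum_e' h (join_walks e e').
Proof.
rewrite pair_bigA (reindex (fun p => join_walks p.1 p.2)) //=.
exists (fun c : {ffun pos2 -> W} => ([ffun s => c (inl s)], [ffun s => c (inr s)])).
  by move=> [e e'] _; congr (_, _); apply/ffunP => s; rewrite !ffunE.
by move=> c _; apply/ffunP => -[s|s]; rewrite !ffunE.
Qed.

Lemma walk_sites_simple e : simple_walk e -> (k <= #|walk_sites e|)%N.
Proof.
move=> /injectiveP eI; rewrite /walk_sites card_imset ?card_ord //.
by move=> s t /(congr1 snd) /eI.
Qed.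

(** The three terms are the pairs with excess, the pairs without common vertex (2 k distinct sites)
    and the pairs of rotations of one walk. The 8 is 2 * 2^2, from the 2 k positions. *)
Lemma joint_prob_le e e' : (8 * k ^ 2 <= n)%N -> simple_walk e -> simple_walk e' ->
  walk_prob R ordS2 (join_walks e e') <=
  (if (#|walk_vertices (join_walks e e')| < #|walk_sites (join_walks e e')|)%N
   then walk_prob R ordS2 (join_walks e e') else 0) +
  (1 + 8 * k%:R ^+ 2 / n%:R) * n%:R ^- (2 * k) +
  \sum_(a < k) (e' == shift_walk a e)%:R * (2 * n%:R ^- k).
Proof.
move=> nk se se'; have nR : 0 < n%:R :> R by rewrite ltr0n.
have nk' : (2 * #|{: pos2}| ^ 2 <= n)%N.
  by rewrite card_sum !card_ord addnn -muln2 expnMn; apply: leq_trans nk; nia.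
have S0 : 0 <= \sum_(a < k) (e' == shift_walk a e)%:R * (2 * n%:R ^- k) :> R.
  by apply: sumr_ge0 => a _; rewrite !mulr_ge0 ?ler0n // invr_ge0 exprn_ge0 // ltW.
have U0 : 0 <= (1 + 8 * k%:R ^+ 2 / n%:R) * n%:R ^- (2 * k) :> R.
  by rewrite mulr_ge0 ?invr_ge0 ?exprn_ge0 ?addr_ge0 ?divr_ge0 ?mulr_ge0 ?exprn_ge0 ?ler0n.
case: ifP => EV; first by rewrite -addrA lerDl addr_ge0.
rewrite add0r.
have [E0|[g]] := set_0Vmem [set g : G | closed_walk ordS2 g (join_walks e e')].
  by rewrite /walk_prob E0 cards0 mul0r addr_ge0.
rewrite inE => ge.
have [/existsP[s /existsP[t /eqP est]]|noint] := boolP [exists s, exists t, (e s).2 == (e' t).2].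
  have [a ea] := shift_of_intersecting ge (negbT EV) est.
  rewrite ler_wpDl // (bigD1 a) //= -ea eqxx mul1r ler_wpDr //.
    by apply: sumr_ge0 => b _; rewrite !mulr_ge0 ?ler0n // invr_ge0 exprn_ge0 // ltW.
  apply: (le_trans (walk_prob_le2 R n_gt0 ordS2 nk' _)).
  rewrite ler_wpM2l // lef_pV2 ?posrE ?exprn_gt0 // ler_weXn2l // ?ler1n //.
  apply: leq_trans (walk_sites_simple se) _; apply: subset_leq_card.
  apply/fintype.subsetP => _ /imsetP[u _ ->].
  by rewrite -(join_walksl e e'); apply: imset_f.
rewrite ler_wpDr //; apply: (le_trans (walk_prob_le R n_gt0 ordS2 nk' _)).
have -> : #|walk_sites (join_walks e e')| = (2 * k)%N.
  rewrite /walk_sites card_imset ?card_sum ?card_ord ?addnn ?mul2n //.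
  have H (s t : 'I_k) : e s <> e' t.
    move=> est; move/existsPn: noint => /(_ s) /existsPn /(_ t).
    by rewrite est eqxx.
  have eI := injectiveP _ se; have eI' := injectiveP _ se'.
  move=> [s|s] [t|t]; rewrite ?join_walksl ?join_walksr.
  - by move=> /(congr1 snd) /eI ->.
  - by move/H.
  - by move/esym/H.
  - by move=> /(congr1 snd) /eI' ->.
rewrite ler_wpM2r ?invr_ge0 ?exprn_ge0 ?ler0n // lerD2l ler_wpM2r ?invr_ge0 ?ler0n //.
by rewrite card_sum !card_ord -!natrX -!natrM ler_nat; nia.
Qed.

Lemma simple_walk_countE g : (simple_walk_count g)%:R =
  \sum_(e | simple_walk e) (closed_walk (@ordS k) g e)%:R :> R.
Proof.
rewrite /simple_walk_count -sum1_card natr_sum big_mkcond [RHS]big_mkcond /=.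
by apply: eq_bigr => e _; rewrite inE; case: closed_walk; case: simple_walk.
Qed.

Lemma avg_simple_sqE : avg (fun g => (simple_walk_count g)%:R ^+ 2) =
  \sum_(e | simple_walk e) \sum_(e' | simple_walk e') walk_prob R ordS2 (join_walks e e').
Proof.
rewrite /avg; under eq_bigr do rewrite simple_walk_countE expr2 mulr_suml.
rewrite exchange_big /= mulr_suml; apply: eq_bigr => e _.
under eq_bigr do rewrite mulr_sumr.
rewrite exchange_big /= mulr_suml; apply: eq_bigr => e' _.
congr (_ / _); rewrite -sum1_card natr_sum [RHS]big_mkcond; apply: eq_bigr => g _.
by rewrite inE closed_join_walks -natrM mulnb; case: (_ && _).
Qed.

Lemma card_walks : #|{: walk}| = ((d * n) ^ k)%N.
Proof. by rewrite card_ffun card_sites card_ord. Qed.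

Lemma avg_simple_sq_le : (8 * k ^ 2 <= n)%N ->
  avg (fun g => (simple_walk_count g)%:R ^+ 2) <=
  2 * ((2 * k).+1 * d ^ (2 * k) * (2 * k) ^ (2 * k))%:R / n%:R +
  (1 + 8 * k%:R ^+ 2 / n%:R) * (d ^ (2 * k))%:R + 2 * (k * d ^ k)%:R.
Proof.
move=> nk; have nR : 0 < n%:R :> R by rewrite ltr0n.
pose F e e' : R := if (#|walk_vertices (join_walks e e')| <
    #|walk_sites (join_walks e e')|)%N then walk_prob R ordS2 (join_walks e e') else 0.
pose u : R := (1 + 8 * k%:R ^+ 2 / n%:R) * n%:R ^- (2 * k).
pose v : R := 2 * n%:R ^- k.
have u0 : 0 <= u.
  by rewrite mulr_ge0 ?invr_ge0 ?exprn_ge0 ?addr_ge0 ?divr_ge0 ?mulr_ge0 ?exprn_ge0 ?ler0n.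
have v0 : 0 <= v by rewrite mulr_ge0 // invr_ge0 exprn_ge0 // ltW.
have F0 e e' : 0 <= F e e' by rewrite /F; case: ifP => // _; apply: walk_prob_ge0.
rewrite avg_simple_sqE.
apply: (@le_trans _ _ (\sum_e \sum_e' (F e e' + u +
    \sum_(a < k) (e' == shift_walk a e)%:R * v))).
  rewrite big_mkcond; apply: ler_sum => e _.
  have T0 e' : 0 <= F e e' + u + \sum_(a < k) (e' == shift_walk a e)%:R * v.
    by rewrite !addr_ge0 // sumr_ge0 // => a _; rewrite mulr_ge0 ?ler0n.
  case: ifP => [se|_]; last exact: sumr_ge0.
  rewrite big_mkcond; apply: ler_sum => e' _; case: ifP => // se'.
  exact: joint_prob_le.
under eq_bigr do rewrite !big_split /=.
rewrite !big_split /=; apply: lerD; first apply: lerD.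
- rewrite -(join_walks_bij (fun c => if (#|walk_vertices c| < #|walk_sites c|)%N
    then walk_prob R ordS2 c else 0)) -big_mkcond /=.
  have := @sum_walk_prob_excess R n d n_gt0 _ ordS2.
  by rewrite card_sum !card_ord addnn -mul2n; apply; apply: leq_trans nk; nia.
- rewrite !sumr_const card_walks -mulrnA -[leLHS]mulr_natl mulnn -expnM mulnC.
  rewrite (mulnC k) expnMn natrM !natrX /u le_eqVlt; apply/orP; left; apply/eqP.
  have nk0 : n%:R ^+ (2 * k) != 0 :> R by rewrite expf_neq0 // gt_eqF.
  by field; rewrite nk0 gt_eqF.
rewrite (eq_bigr (fun=> k%:R * v)); last first.
  move=> e _; rewrite exchange_big /= (eq_bigr (fun=> v)) ?sumr_const ?card_ord ?mulr_natl //.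
  move=> a _; rewrite (bigD1 (shift_walk a e)) //= eqxx mul1r big1 ?addr0 //.
  by move=> e' /negPf ->; rewrite mul0r.
rewrite sumr_const card_walks -[leLHS]mulr_natl natrX natrM exprMn /v.
rewrite le_eqVlt; apply/orP; left; apply/eqP; rewrite natrM natrX.
have nk0 : n%:R ^+ k != 0 :> R by rewrite expf_neq0 // gt_eqF.
by field.
Qed.

Lemma ffact_ge : (k <= n)%N ->
  n%:R ^+ k * (1 - k%:R ^+ 2 / n%:R) <= (n ^_ k)%:R :> R.
Proof.
have nR : 0 < n%:R :> R by rewrite ltr0n.
elim: (k) => [|j IH] jn; first by rewrite expr0n /= mul0r subr0 mul1r ffactn0.
rewrite ffactnSr natrM natrB 1?ltnW //.
have nj : 0 <= n%:R - j%:R :> R by rewrite subr_ge0 ler_nat ltnW.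
apply: le_trans (ler_wpM2r nj (IH (ltnW jn))).
have -> : n%:R - j%:R = n%:R * (1 - j%:R / n%:R) :> R by field; rewrite gt_eqF.
rewrite exprSr -[leLHS]mulrA -[leRHS]mulrA ler_wpM2l ?exprn_ge0 ?ler0n //.
rewrite [leRHS]mulrCA ler_wpM2l ?ler0n //.
rewrite -subr_ge0 -natr1.
have -> : (1 - j%:R ^+ 2 / n%:R) * (1 - j%:R / n%:R) - (1 - (j%:R + 1) ^+ 2 / n%:R) =
   (j%:R + 1) / n%:R + j%:R ^+ 2 / n%:R * (j%:R / n%:R) :> R by field; rewrite gt_eqF.
by rewrite addr_ge0 ?mulr_ge0 ?addr_ge0 ?invr_ge0 ?exprn_ge0 ?ler0n.
Qed.

Lemma card_simple_walk : #|[set e | simple_walk e]| = (d ^ k * n ^_ k)%N.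
Proof.
apply/eqP; rewrite -(eqr_nat R); apply/eqP.
rewrite -sum1_card natr_sum big_mkcond /=.
rewrite (eq_bigr (fun e => if simple_walk e then 1 else 0)) => [|e _]; last by rewrite inE.
rewrite sum_zip_tuple.
transitivity (\sum_(c : {ffun 'I_k -> 'I_d}) (n ^_ k)%:R : R); last first.
  by rewrite sumr_const card_ffun !card_ord -mulrnA mulnC.
apply: eq_bigr => c _; rewrite -big_mkcond sumr_const.
rewrite -[n in RHS]card_ord -[k in RHS]card_ord -card_inj_ffuns; congr (_%:R).
apply: eq_card => x; rewrite [RHS]inE; apply/injectiveP/injectiveP => xI s t.
  by move=> xst; apply: xI; rewrite !ffunE.
by rewrite !ffunE => /xI.
Qed.

Lemma avg_simple_ge : (k <= n)%N ->
  d%:R ^+ k * (1 - k%:R ^+ 2 / n%:R) <= avg (fun g => (simple_walk_count g)%:R).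
Proof.
move=> kn; have nR : 0 < n%:R :> R by rewrite ltr0n.
rewrite avg_count.
apply: (@le_trans _ _ (\sum_(e | simple_walk e) n%:R ^- k)).
  rewrite sumr_const -[leRHS]mulr_natl ler_pdivlMr ?exprn_gt0 // -mulrA.
  have -> : #|[pred e | simple_walk e]| = (d ^ k * n ^_ k)%N.
    by rewrite -card_simple_walk cardsE.
  by rewrite natrM natrX ler_wpM2l ?exprn_ge0 ?ler0n // mulrC ffact_ge.
apply: ler_sum => e /injectiveP eI.
rewrite ler_pdivlMr ?card_G_gt0 // mulrC ler_pdivrMr ?exprn_gt0 //.
rewrite -natrX -natrM ler_nat mulnC.
have oI : injective (@ordS k) by exact: ordS_inj.
by have := card_closed_walk_ge oI eI; rewrite !card_ord.
Qed.

(* Collects the constants of the [O(d ^ (2 * k) / n)] error terms below. *)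
Definition walk_threshold := (10 * k ^ 2 + 2 * ((2 * k).+1 * (2 * k) ^ (2 * k)))%N.

Lemma avg_walk_count (s : R) : 0 < s -> s ^+ 2 = d%:R ^+ k ->
  (walk_threshold * d ^ (2 * k) <= n)%N ->
  avg (fun g => `|(walk_count g)%:R - d%:R ^+ k|) <= (4 * k)%:R * s.
Proof.
move=> s_gt0 sE big_n; have nR : 0 < n%:R :> R by rewrite ltr0n.
have D1 : 1 <= d%:R ^+ k :> R by rewrite exprn_ege1 // ler1n.
have s1 : 1 <= s by rewrite -(@ler_pXn2r _ 2) ?nnegrE ?(ltW s_gt0) // sE expr1n.
have k1 : 1 <= k%:R :> R by rewrite ler1n.
have D2 : (0 < d ^ (2 * k))%N by rewrite expn_gt0 d_gt0.
have n10 : (10 * k ^ 2 <= n)%N.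
  by apply: leq_trans big_n; rewrite /walk_threshold; nia.
have walk_split g : (walk_count g)%:R = (simple_walk_count g)%:R +
    #|[set e | closed_walk (@ordS k) g e && ~~ simple_walk e]|%:R :> R.
  rewrite -natrD; congr (_%:R); rewrite /walk_count /simple_walk_count.
  rewrite -(cardsID [set e | simple_walk e] [set e | closed_walk (@ordS k) g e]).
  by congr (_ + _)%N; apply: eq_card => e; rewrite !inE // andbC.
apply: (@le_trans _ _ (avg (fun g => `|(simple_walk_count g)%:R - d%:R ^+ k| +
    #|[set e | closed_walk (@ordS k) g e && ~~ simple_walk e]|%:R))).
  apply: avg_le => g; rewrite walk_split addrAC.
  by apply: (le_trans (ler_normD _ _)); rewrite lerD2l ger0_norm ?ler0n.
rewrite avgD avg_count.
pose T : R := 2 * ((2 * k).+1 * d ^ (2 * k) * (2 * k) ^ (2 * k))%:R / n%:R.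
pose q : R := k%:R ^+ 2 / n%:R; pose D : R := d%:R ^+ k.
have q0 : 0 <= q by rewrite divr_ge0 ?exprn_ge0 ?ler0n.
have T0 : 0 <= T by rewrite divr_ge0 ?mulr_ge0 ?ler0n.
(* All errors of relative order 1/n: 8 comes from the second moment of the simple count and 2 from
   the cross term with its mean. [walk_threshold] is designed for this bound. *)
have TqD : T + 10 * q * D ^+ 2 <= 1.
  have -> : T + 10 * q * D ^+ 2 = (walk_threshold * d ^ (2 * k))%:R / n%:R.
    rewrite /T /q /D -exprM [(k * 2)%N]mulnC /walk_threshold.
    by rewrite !(natrM, natrD, natrX); field; rewrite gt_eqF.
  by rewrite ler_pdivrMr // mul1r ler_nat.
(* By |y| <= (s^2 + y^2) / (2 s) it is enough to bound the second moment about [D], which is at most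
   2 k D + 1. *)
have E1 : avg (fun g => `|(simple_walk_count g)%:R - d%:R ^+ k|) <= 2 * k%:R * s.
  apply: (@le_trans _ _ (avg (fun g => (2 * s)^-1 * (s ^+ 2 +
     ((simple_walk_count g)%:R ^+ 2 + - (2 * d%:R ^+ k) * (simple_walk_count g)%:R +
      d%:R ^+ k ^+ 2))))).
    apply: avg_le => g; rewrite mulrC ler_pdivlMr ?mulr_gt0 //.
    set z := (simple_walk_count g)%:R; rewrite -/D.
    have : 0 <= (s - `|z - D|) ^+ 2 by rewrite sqr_ge0.
    rewrite sqrrB real_normK ?num_real // => H; nra.
  rewrite avgZ !avgD (avgZ (- (2 * d%:R ^+ k))) !avgC mulrC ler_pdivrMr ?mulr_gt0 //.
  have A : (8 * k ^ 2 <= n)%N by apply: leq_trans n10; rewrite leq_mul2r orbT.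
  have {}A := avg_simple_sq_le A.
  have B : (k <= n)%N.
    by apply: leq_trans n10; rewrite -mulnn mulnA leq_pmull // muln_gt0.
  have {}B := avg_simple_ge B.
  move: A B; rewrite -/T natrM !natrX (mulnC 2%N) exprM sE -/D -[8 * _ / _]mulrA -/q.
  set Z2 := avg _; set Z1 := avg _ => A B.
  have DB : D * (D * (1 - q)) <= D * Z1 by rewrite ler_wpM2l // (le_trans ler01).
  have kD : 0 <= (k%:R - 1) * (D - 1) by rewrite mulr_ge0 // subr_ge0.
  have ssD : 2 * k%:R * s * (2 * s) = 4 * k%:R * D.
    by rewrite /D -sE; ring.
  by rewrite ssD; clearbody T q D Z1 Z2; nra.
have E2 : \sum_(e | ~~ simple_walk e) walk_prob R (@ordS k) e <= (1 + k%:R) * s.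
  have nk : (2 * k ^ 2 <= n)%N by apply: leq_trans n10; rewrite leq_mul2r orbT.
  apply: (le_trans (non_simple_walks nk)).
  rewrite [leRHS]mulrDl mul1r; apply: lerD.
    apply: (@le_trans _ _ T); last first.
      apply: le_trans s1; apply: le_trans TqD.
      by rewrite lerDl !mulr_ge0 // exprn_ge0 // (le_trans ler01).
    rewrite ler_wpM2r ?invr_ge0 ?ler0n // ler_wpM2l // ler_nat.
    rewrite -!mulnA leq_mul //; first by rewrite ltnS leq_pmull.
    rewrite leq_mul //; first by rewrite leq_pexp2l // mul2n -addnn leq_addr.
    apply: (@leq_trans ((2 * k) ^ k)); first by rewrite leq_exp2r // mul2n -addnn leq_addr.
    by rewrite leq_pexp2l ?muln_gt0 // mul2n -addnn leq_addr.
  rewrite ler_wpM2l ?ler0n // -(@ler_pXn2r _ 2) ?nnegrE ?(ltW s_gt0) ?exprn_ge0 ?ler0n //.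
  rewrite sE -exprM ler_weXn2l ?ler1n //.
  by rewrite muln2 -[leqRHS]odd_double_half leq_addl.
apply: (le_trans (lerD E1 E2)).
by rewrite -mulrDl ler_wpM2r ?(ltW s_gt0) // natrM; lra.
Qed.

End CyclicWalks.

(** * Spectrum of a sum of permutation matrices *)

Section Spectra.

(** Sylvester's identity without division, for use with the scalar ['X]. *)
Lemma det_sub_mulmxC (R : comPzRingType) m n (a : R) (U : 'M[R]_(m, n)) (V : 'M[R]_(n, m)) :
  \det (a%:M - U *m V) * a ^+ n = a ^+ m * \det (a%:M - V *m U).
Proof.
have E : block_mx a%:M U V 1%:M = block_mx 1%:M U 0 1%:M *m block_mx (a%:M - U *m V) 0 V 1%:M.
  by rewrite mulmx_block !mul1mx !mul0mx !mulmx1 !add0r subrK.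
transitivity (\det (block_mx a%:M U V 1%:M) * \det (block_mx 1%:M (- U) 0 a%:M)).
  by rewrite E det_mulmx !det_ublock det_lblock !det1 !mul1r !mulr1 det_scalar.
rewrite -det_mulmx mulmx_block !mulmx1 !mulmx0 !addr0 mul1mx !mulmxN.
have -> : - (a%:M *m U) + U *m a%:M = 0 by rewrite mul_mx_scalar mul_scalar_mx addrC subrr.
by rewrite det_lblock det_scalar addrC.
Qed.

Variables (C : numClosedFieldType) (n : nat).

Lemma trig_mulmx (A B : 'M[C]_n) : is_trig_mx A -> is_trig_mx B ->
  is_trig_mx (A *m B) /\ forall i, (A *m B) i i = A i i * B i i.
Proof.
move=> /is_trig_mxP At /is_trig_mxP Bt; split.
  apply/is_trig_mxP => i j ij; rewrite mxE big1 // => l _.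
  have [il|li] := ltnP i l; first by rewrite At ?mul0r.
  by rewrite Bt ?mulr0 // (leq_ltn_trans li).
move=> i; rewrite mxE (bigD1 i) //= big1 ?addr0 // => l li.
have [il|il] := ltnP i l; first by rewrite At ?mul0r.
by rewrite Bt ?mulr0 // ltn_neqAle il andbT.
Qed.

Lemma eigenvalue_list (A : 'M[C]_n) : (0 < n)%N -> exists l : seq C,
  [/\ char_poly A = \prod_(a <- l) ('X - a%:P),
      recip_poly l = \det (1%:M - 'X *: map_mx polyC A)
    & forall k, \tr (A ^+ k) = power_sum l k].
Proof.
move=> n_gt0; have [P /unitarymx_unit Pu] := Schur A n_gt0.
rewrite -[similar_trig P A]/(is_trig_mx (conjmx P A)) conjumx //.
move=> Bt.
have : A = invmx P *m (P *m A *m invmx P) *m P.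
  by rewrite !mulmxA mulVmx // mul1mx -mulmxA mulVmx // mulmx1.
move: (P *m A *m invmx P) Bt => B Bt AE.
have conj_pow k : A ^+ k = invmx P *m B ^+ k *m P.
  elim: k => [|k IH]; first by rewrite !expr0 mulmx1 mulVmx.
  rewrite exprS -[A * _]/(A *m _) IH [X in X *m _]AE (exprS B) -[B * _]/(B *m _).
  by rewrite !mulmxA mulmxK.
have Bk k : is_trig_mx (B ^+ k) /\ forall i, (B ^+ k) i i = B i i ^+ k.
  elim: k => [|k [IH1 IH2]]; last first.
    rewrite exprS; have [? E] := trig_mulmx Bt IH1; split=> // i.
    by rewrite E IH2 exprS.
  rewrite expr0; split; first exact: scalar_mx_is_trig.
  by move=> i; rewrite mxE eqxx expr0.
have detE (a b : {poly C}) : \det (a%:M - b *: map_mx polyC A) =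
    \prod_(i < n) (a - b * (B i i)%:P).
  have -> : a%:M - b *: map_mx polyC A = map_mx polyC (invmx P) *m
      (a%:M - b *: map_mx polyC B) *m map_mx polyC P.
    rewrite mulmxBr mulmxBl mul_mx_scalar -scalemxAl -map_mxM mulVmx // map_mx1.
    by rewrite scalemx1 -scalemxAr -scalemxAl -!map_mxM -AE.
  rewrite !det_mulmx mulrAC -det_mulmx -map_mxM mulVmx // map_mx1 det1 mul1r.
  rewrite det_trig; last first.
    apply/is_trig_mxP => i j ij; rewrite !mxE (is_trig_mxP Bt) // mulr0 subr0.
    by rewrite -val_eqE /= ltn_eqF.
  by apply: eq_bigr => i _; rewrite !mxE eqxx.
exists [seq B i i | i <- enum 'I_n]; split.
- rewrite big_map big_enum /= /char_poly /char_poly_mx -[map_mx _ A]scale1r detE.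
  by apply: eq_bigr => i _; rewrite mul1r.
- rewrite detE /recip_poly big_map big_enum /=.
  by apply: eq_bigr => i _; rewrite mulrC.
move=> k; rewrite conj_pow mxtrace_mulC mulmxA mulmxV // mul1mx.
rewrite /power_sum big_map big_enum /=; apply: eq_bigr => i _.
by have [_ ->] := Bk k.
Qed.

End Spectra.

(** * The sum of permutation matrices and its centred version *)

Section AdjacencyMatrix.

Variables (R : realFieldType) (n d : nat).
Hypothesis n_gt0 : (0 < n)%N.
Local Notation W := ('I_d * 'I_n)%type.
Local Notation G := {ffun 'I_d -> 'S_n}.
Implicit Types (g : G).

Definition perm_sum g : 'M[R]_n := \sum_l perm_mx (g l).

Definition centered_sum g : 'M[R]_n := \matrix_(i, j) sum_centered R g i j.

Definition ones_mx : 'M[R]_n := const_mx 1.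

Let nR_neq0 : n%:R != 0 :> R. Proof. by rewrite pnatr_eq0 -lt0n. Qed.

Lemma perm_sumE g i j : perm_sum g i j = \sum_l (g l i == j)%:R.
Proof. by rewrite summxE; apply: eq_bigr => l _; rewrite !mxE. Qed.

Lemma centered_sumE g : centered_sum g = perm_sum g - (d%:R / n%:R) *: ones_mx.
Proof.
apply/matrixP => i j; rewrite !mxE summxE mulr1 /sum_centered /centered sumrB.
rewrite sumr_const card_ord -[_^-1 *+ _]mulr_natl; congr (_ - _).
by apply: eq_bigr => l _; rewrite !mxE.
Qed.

Lemma perm_sum_ones g : perm_sum g *m ones_mx = d%:R *: ones_mx.
Proof.
apply/matrixP => i j; rewrite !mxE mulr1; under eq_bigr do rewrite mxE mulr1 perm_sumE.
rewrite exchange_big /= -[d in RHS]card_ord -sumr_const; apply: eq_bigr => l _.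
by under eq_bigr do rewrite -[_%:R]mulr1; rewrite sum_delta.
Qed.

Lemma ones_perm_sum g : ones_mx *m perm_sum g = d%:R *: ones_mx.
Proof.
apply/matrixP => i j; rewrite !mxE mulr1; under eq_bigr do rewrite mxE mul1r perm_sumE.
rewrite exchange_big /= -[d in RHS]card_ord -sumr_const; apply: eq_bigr => l _.
rewrite -[RHS](sum_delta ((g l)^-1 j)%g (fun=> 1)); apply: eq_bigr => i' _.
by rewrite mulr1 (canF_eq (permK (g l))) eq_sym.
Qed.

Lemma ones_ones : ones_mx *m ones_mx = n%:R *: ones_mx.
Proof.
apply/matrixP => i j; rewrite !mxE; under eq_bigr do rewrite !mxE mulr1.
by rewrite sumr_const card_ord mulr1.
Qed.

Lemma ones_perm_sumX g k : ones_mx *m perm_sum g ^+ k = d%:R ^+ k *: ones_mx.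
Proof.
elim: k => [|k IH]; first by rewrite !expr0 mulmx1 scale1r.
by rewrite exprSr mulmxA IH -scalemxAl ones_perm_sum scalerA -exprSr.
Qed.

(** Uses A J = J A = d J and J^2 = n J. The exponent must be positive: at exponent 0 the term in J
    would not appear. *)
Lemma centered_sumX g k :
  centered_sum g ^+ k.+1 = perm_sum g ^+ k.+1 - (d%:R ^+ k.+1 / n%:R) *: ones_mx.
Proof.
elim: k => [|k IH]; first by rewrite !expr1 centered_sumE.
rewrite exprS IH centered_sumE -[_ * _]/(_ *m _) mulmxBl !mulmxBr -!scalemxAl -!scalemxAr.
rewrite ones_perm_sumX perm_sum_ones ones_ones !scalerA.
have -> : d%:R / n%:R * (d%:R ^+ k.+1 / n%:R) * n%:R = d%:R ^+ k.+2 / n%:R :> R.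
  by rewrite -mulrA divfK // mulrAC -exprS.
have -> : d%:R ^+ k.+1 / n%:R * d%:R = d%:R ^+ k.+2 / n%:R :> R.
  by rewrite mulrAC -exprSr.
have -> : d%:R / n%:R * d%:R ^+ k.+1 = d%:R ^+ k.+2 / n%:R :> R.
  by rewrite mulrAC -exprS.
by rewrite subrr subr0 (exprS _ k.+1).
Qed.

Lemma trace_centered_sumX g k :
  \tr (centered_sum g ^+ k.+1) = \tr (perm_sum g ^+ k.+1) - d%:R ^+ k.+1.
Proof.
rewrite centered_sumX linearB linearZ /=; congr (_ - _).
rewrite /mxtrace; under eq_bigr do rewrite mxE.
by rewrite sumr_const card_ord divfK.
Qed.

Lemma trace_perm_mx (s : 'S_n) : \tr (perm_mx s) = #|[set i | s i == i]|%:R :> R.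
Proof.
rewrite -sum1_card natr_sum big_mkcond; apply: eq_bigr => i _.
by rewrite !mxE inE; case: eqP.
Qed.

Lemma perm_sumX g k : perm_sum g ^+ k =
  \sum_(w : {ffun 'I_k -> 'I_d}) perm_mx (\prod_(s < k) g (w s))%g.
Proof.
transitivity (\prod_(s < k) perm_sum g); first by rewrite prodr_const card_ord.
rewrite /perm_sum bigA_distr_bigA; apply: eq_bigr => w _.
by rewrite (big_morph (fun s => perm_mx s : 'M[R]_n) (@perm_mxM _ _) (perm_mx1 _ _)).
Qed.

(** For a fixed colour word a closed walk is determined by its start, through the partial products
    [u]; it closes up when the full product fixes the start. *)
Lemma card_closed_fixed g k (w : {ffun 'I_k.+1 -> 'I_d}) :
  #|[set v : {ffun 'I_k.+1 -> 'I_n} | closed_walk (@ordS k.+1) g (zip_tuple w v)]| =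
  #|[set i | (\prod_(s < k.+1) g (w s))%g i == i]|.
Proof.
pose u s : 'S_n := (\prod_(0 <= t < s) g (w (inord t)))%g.
have uS (s : 'I_k.+1) i : u s.+1 i = g (w s) (u s i).
  by rewrite /u big_nat_recr //= permM inord_val.
have uk : u k.+1 = (\prod_(s < k.+1) g (w s))%g.
  by rewrite /u big_mkord; apply: eq_bigr => s _; rewrite inord_val.
have ordSE (s : 'I_k.+1) : (s < k)%N -> ordS s = s.+1 :> nat.
  by move=> sk; rewrite /= modn_small.
have walkE (v : {ffun 'I_k.+1 -> 'I_n}) (s : 'I_k.+1) :
    closed_walk (@ordS k.+1) g (zip_tuple w v) -> v s = u s (v ord0).
  move=> /forallP gv; case: s; elim=> [|s IH] sk.
    by rewrite /u big_nil perm1; congr (v _); apply/val_inj.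
  have sk' := ltnW sk; rewrite (uS (Ordinal sk')) -IH.
  have /eqP := gv (Ordinal sk'); rewrite !ffunE /= => ->; congr (v _).
  by apply/val_inj; rewrite /= modn_small.
pose f i : {ffun 'I_k.+1 -> 'I_n} := [ffun s : 'I_k.+1 => u s i].
have fI : injective f.
  by move=> i j /ffunP /(_ ord0); rewrite !ffunE => /perm_inj.
rewrite -(card_imset _ fI); apply: eq_card => v; rewrite inE.
apply/idP/imsetP => [gv|[i + ->]].
  exists (v ord0); last by apply/ffunP => s; rewrite ffunE -walkE.
  rewrite inE -uk (uS ord_max) -walkE //.
  have /forallP /(_ ord_max) := gv; rewrite !ffunE /= => /eqP ->; apply/eqP.
  by congr (v _); apply/val_inj; rewrite /= modnn.
rewrite inE -uk => /eqP ui; apply/forallP => s; rewrite !ffunE /= -uS; apply/eqP.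
have [sk|ks] := ltnP s k; first by rewrite modn_small.
have -> : s = k :> nat by apply/eqP; rewrite eqn_leq ks -ltnS ltn_ord.
by rewrite modnn ui /u big_nil perm1.
Qed.

Lemma trace_walk_count g k : \tr (perm_sum g ^+ k.+1) = (walk_count k.+1 g)%:R.
Proof.
rewrite perm_sumX raddf_sum /=; under eq_bigr do rewrite trace_perm_mx -card_closed_fixed.
rewrite /walk_count -[in RHS]sum1_card natr_sum [RHS]big_mkcond [RHS]sum_zip_tuple.
apply: eq_bigr => w _; rewrite -sum1_card natr_sum big_mkcond /=.
by apply: eq_bigr => v _; rewrite !inE.
Qed.

(** Since M J = 0 for the centred matrix M, (X - M)(X - (d/n) J) = X (X - A); take determinants.
    Thus A has the spectrum of M with one 0 replaced by d. *)
Lemma char_poly_perm_sum g :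
  char_poly (perm_sum g) * 'X = char_poly (centered_sum g) * ('X - d%:R%:P).
Proof.
pose J : 'M[{poly R}]_n := map_mx polyC ones_mx.
pose c : {poly R} := (d%:R / n%:R)%:P.
have E : ('X%:M - map_mx polyC (centered_sum g)) *m ('X%:M - c *: J) =
    'X *: ('X%:M - map_mx polyC (perm_sum g)).
  have MJ : map_mx polyC (centered_sum g) *m J = 0.
    rewrite -map_mxM centered_sumE mulmxBl perm_sum_ones -scalemxAl ones_ones scalerA.
    by rewrite divfK // subrr map_mx0.
  have -> : map_mx polyC (perm_sum g) = map_mx polyC (centered_sum g) + c *: J.
    by rewrite centered_sumE map_mxB map_mxZ subrK.
  rewrite mulmxBl !mulmxBr -[map_mx _ _ *m (c *: J)]scalemxAr MJ scaler0 subr0.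
  by rewrite !mul_scalar_mx mul_mx_scalar -!scalerBr opprD addrA addrAC.
have detJ : \det ('X%:M - c *: J) * 'X = 'X^n * ('X - d%:R%:P).
  have -> : c *: J = (const_mx c : 'cV_n) *m (const_mx 1 : 'rV_n).
    by apply/matrixP => i j; rewrite !mxE big_ord1 !mxE.
  rewrite -{1}[X in _ * X]expr1 det_sub_mulmxC det_mx11 !mxE; congr (_ * (_ - _)).
  under eq_bigr do rewrite !mxE mul1r.
  by rewrite sumr_const card_ord -[LHS]mulr_natr -polyC_natr -polyCM divfK.
have Xn0 : 'X^n != 0 :> {poly R} by rewrite expf_neq0 // polyX_eq0.
apply: (mulfI Xn0); rewrite mulrA [in RHS]mulrCA -detJ mulrA.
have := congr1 determinant E; rewrite det_mulmx detZ => E'.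
by rewrite /char_poly /char_poly_mx E'.
Qed.

End AdjacencyMatrix.

Section RecipPoly.

Variable C : numFieldType.
Implicit Type l : seq C.

Lemma size_recip_poly l :
  (size (recip_poly l) <= (size l).+1)%N.
Proof.
elim: l => [|a l IH]; first by rewrite /recip_poly big_nil size_poly1.
rewrite /recip_poly big_cons; apply: leq_trans (size_polyMleq _ _) _ => /=.
have : (size (1 - a%:P * 'X)%R <= 2)%N.
  rewrite (leq_trans (size_polyD _ _)) // geq_max size_poly1 /= size_polyN.
  by rewrite (leq_trans (size_polyMleq _ _)) // size_polyX addn2 /= size_polyC; case: eqP.
by move=> h; rewrite -subn1 leq_subLR add1n (leq_trans (leq_add h IH)).
Qed.

Lemma root_recip_poly l a : a \in l -> a != 0 -> root (recip_poly l) a^-1.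
Proof.
move=> al a0; apply/rootP; rewrite /recip_poly horner_prod (big_rem a) //=.
by rewrite hornerD hornerN hornerCM hornerX hornerC mulfV // subrr mul0r.
Qed.

End RecipPoly.

Lemma map_mx_expr (R S : pzRingType) (f : {rmorphism R -> S}) n (A : 'M[R]_n) k :
  map_mx f (A ^+ k) = map_mx f A ^+ k.
Proof.
by elim: k => [|k IH]; [rewrite !expr0 map_mx1|rewrite !exprS map_mxM IH].
Qed.

Section LargeEigenvalues.

Variables (R : realType) (n d : nat).
Hypothesis n_gt0 : (0 < n)%N.
Local Notation G := {ffun 'I_d -> 'S_n}.
Local Notation toC := (real_complex R).
Implicit Types (g : G).

Definition coef_norm g k : R :=
  `|\sum_(x : {ffun 'I_k -> 'I_n}) sub_det (sum_centered R g) x x| / k`!%:R.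

Definition trace_norm g k : R := `|(walk_count k g)%:R - d%:R ^+ k|.

Lemma norm_toC (x : R) : `|toC x| = toC `|x|.
Proof.
have [x0|x0] := leP 0 x; first by rewrite !ger0_norm ?lecR.
by rewrite !ltr0_norm // ?rmorphN //= ltcR.
Qed.

Lemma coef_abs_recip (l : seq R[i]) g k :
  recip_poly l = \det (1%:M - 'X *: map_mx polyC (map_mx toC (centered_sum R g))) ->
  (abs_poly (recip_poly l))`_k = toC (coef_norm g k).
Proof.
move=> lE; rewrite coef_abs_poly.
have kf : k`!%:R != 0 :> R[i] by rewrite pnatr_eq0 -lt0n fact_gt0.
apply: (mulfI kf); rewrite -{1}[k`!%:R]normr_nat -normrM lE.
have -> : 1%:M - 'X *: map_mx polyC (map_mx toC (centered_sum R g)) =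
    1%:M + 'X *: map_mx polyC (- map_mx toC (centered_sum R g)).
  by rewrite map_mxN scalerN.
rewrite coef_det_add1X.
have -> : \sum_(x : {ffun 'I_k -> 'I_n}) sub_det (- map_mx toC (centered_sum R g)) x x =
    (-1) ^+ k * toC (\sum_(x : {ffun 'I_k -> 'I_n}) sub_det (sum_centered R g) x x).
  rewrite rmorph_sum mulr_sumr; apply: eq_bigr => x _.
  rewrite /sub_det -det_map_mx -detZ; congr determinant.
  by apply/matrixP => s t; rewrite !mxE mulN1r.
rewrite normrM normrX normrN1 expr1n mul1r norm_toC /coef_norm.
by rewrite rmorphM fmorphV !rmorph_nat mulrC divfK.
Qed.

(** [root_recip_poly_bound] at the inverse of [z], with its complex quantities rewritten as real
    ones. *)
Lemma large_root_bound g (theta rho : R) K (z : R[i]) :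
  0 < theta -> 0 < rho -> theta^-1 <= rho ->
  root (char_poly (map_mx toC (centered_sum R g))) z -> toC theta < `|z| ->
  1 <= (theta^-1 / rho) ^+ K.+1 * ((\sum_(i < n.+1) coef_norm g i * rho ^+ i) *
    trunc_exp K (\sum_(k < K) trace_norm g k.+1 / k.+1%:R * rho ^+ k.+1)).
Proof.
move=> th0 rho0 thr rz zth.
have [l [cl rl tl]] := eigenvalue_list (map_mx toC (centered_sum R g)) n_gt0.
have z0 : z != 0 by rewrite -normr_gt0 (le_lt_trans _ zth) // lecR ltW.
have lz : root (recip_poly l) z^-1.
  by apply: root_recip_poly z0; rewrite cl root_prod_XsubC in rz.
have zr : `|z^-1| <= toC theta^-1.
  rewrite normfV fmorphV lef_pV2 ?posrE ?normr_gt0 ?ltcR //; exact: ltW.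
have th0' : (0 : R[i]) <= toC theta^-1 by rewrite -[0]/(toC 0) lecR invr_ge0 ltW.
have thr' : toC theta^-1 <= toC rho by rewrite lecR.
have rho0' : (0 : R[i]) < toC rho by rewrite -[0]/(toC 0) ltcR.
have := root_recip_poly_bound K lz zr th0' thr' rho0'.
have -> : (abs_poly (recip_poly l)).[toC rho] =
    toC (\sum_(i < n.+1) coef_norm g i * rho ^+ i).
  rewrite (@horner_coef_wide _ n.+1); last first.
    have sl : size l = n.
      have := size_char_poly (map_mx toC (centered_sum R g)).
      by rewrite cl size_prod_XsubC => -[].
    by rewrite -sl (leq_trans (size_poly _ _)) // size_recip_poly.
  rewrite rmorph_sum; apply: eq_bigr => i _.
  by rewrite (coef_abs_recip _ rl) [RHS]rmorphM [in RHS]rmorphXn.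
have -> : \sum_(k < K) `|power_sum l k.+1| / k.+1%:R * toC rho ^+ k.+1 =
    toC (\sum_(k < K) trace_norm g k.+1 / k.+1%:R * rho ^+ k.+1).
  rewrite rmorph_sum; apply: eq_bigr => k _.
  rewrite -tl !rmorphM fmorphV rmorph_nat rmorphXn -map_mx_expr trace_map_mx norm_toC.
  by rewrite trace_centered_sumX // trace_walk_count.
rewrite /trunc_exp.
have -> (x : R) : \sum_(j < K.+1) j`!%:R^-1 * toC x ^+ j = toC (trunc_exp K x).
  by rewrite rmorph_sum; apply: eq_bigr => j _; rewrite rmorphM fmorphV rmorph_nat rmorphXn.
by rewrite -!rmorphM -fmorph_div -rmorphXn -rmorphM -[1]/(toC 1) lecR.
Qed.

End LargeEigenvalues.

(** * Probability of a large second eigenvalue *)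

Section ExceptionalProbability.

Variables (R : realType).
Local Notation toC := (real_complex R).

Lemma trunc_exp_le_expR K (x : R) : 0 <= x -> trunc_exp K x <= expR x.
Proof.
move=> x0; rewrite /trunc_exp.
have -> : \sum_(j < K.+1) j`!%:R^-1 * x ^+ j = series (exp_coeff x) K.+1.
  by rewrite /series /= big_mkord; apply: eq_bigr => j _; rewrite /exp_coeff /= mulrC.
apply: nondecreasing_cvgn_le; last exact: is_cvg_series_exp_coeff.
by apply: nondecreasing_series => j _ _; rewrite /exp_coeff /= divr_ge0 ?exprn_ge0.
Qed.

Lemma trunc_exp_mono K (x y : R) : 0 <= x -> x <= y -> trunc_exp K x <= trunc_exp K y.
Proof.
move=> x0 xy; apply: ler_sum => j _.
by rewrite ler_wpM2l ?invr_ge0 ?ler0n // lerXn2r ?nnegrE // (le_trans x0).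
Qed.

Lemma geometric_sum_le N (x : R) : 0 <= x < 1 -> \sum_(i < N) x ^+ i <= (1 - x)^-1.
Proof.
move=> /andP[x0 x1]; rewrite -[leRHS]mul1r ler_pdivlMr ?subr_gt0 //.
by rewrite mulrC -[1 - x]opprB mulNr -subrX1 opprB lerBlDr lerDl exprn_ge0.
Qed.

Variables (n d : nat).
Hypotheses (n_gt0 : (0 < n)%N) (d_gt0 : (0 < d)%N).
Local Notation G := {ffun 'I_d -> 'S_n}.
Implicit Types (g : G).

Lemma avg_sum (I : finType) (F : I -> G -> R) :
  avg (fun g => \sum_i F i g) = \sum_i avg (F i).
Proof. by rewrite /avg exchange_big mulr_suml. Qed.

(** From the second moment, by c <= (s^(2k) + c^2) / (2 s^k). *)
Lemma avg_coef_norm k (s : R) : 0 < s -> s ^+ 2 = d%:R ->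
  avg (fun g => coef_norm R g k) <= s ^+ k.
Proof.
move=> s0 sE; have sk : 0 < s ^+ k by rewrite exprn_gt0.
have skE : s ^+ k ^+ 2 = d%:R ^+ k by rewrite exprAC sE.
have G0 : 0 < #|G|%:R :> R := card_G_gt0 R n d.
have kf : 0 < k`!%:R :> R by rewrite ltr0n fact_gt0.
apply: (@le_trans _ _ (avg (fun g => (2 * s ^+ k)^-1 * (s ^+ k ^+ 2 + coef_norm R g k ^+ 2)))).
  apply: avg_le => g; rewrite mulrC ler_pdivlMr ?mulr_gt0 //.
  have : 0 <= (s ^+ k - coef_norm R g k) ^+ 2 by rewrite sqr_ge0.
  by rewrite sqrrB; lra.
rewrite avgZ avgD avgC mulrC ler_pdivrMr ?mulr_gt0 //.
suff : avg (fun g => coef_norm R g k ^+ 2) <= s ^+ k ^+ 2 by rewrite expr2; lra.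
rewrite /avg ler_pdivrMr // skE.
have := sum_minors_second_moment R d k n_gt0; rewrite -mulrA natrX.
rewrite -(@ler_pM2l _ (k`!%:R ^+ 2)^-1) ?invr_gt0 ?exprn_gt0 // mulKf ?gt_eqF ?exprn_gt0 //.
apply: le_trans; rewrite mulr_sumr; apply: ler_sum => g _.
by rewrite /coef_norm expr_div_n real_normK ?num_real // mulrC.
Qed.

Definition has_large_root (theta : R) g : bool :=
  `[< exists z, root (char_poly (map_mx toC (centered_sum R g))) z /\ toC theta < `|z| >].

(** A large root forces one of the two factors to exceed its mean bound, [B] or 4 B, by a factor 1 /
    eta, since [hK] rules out that both are small. Each event has probability at most [eta]. *)
Lemma avg_large_root (x eta : R) (K : nat) : 0 < x -> 0 < eta ->
  let B := (1 - (1 + x) / (1 + 2 * x))^-1 in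
  (1 + x)^-1 ^+ K.+1 * (B / eta * expR (4 * B / eta)) < 1 ->
  (forall k, (k < K)%N -> (walk_threshold k.+1 * d ^ (2 * k.+1) <= n)%N) ->
  avg (fun g => (has_large_root (Num.sqrt d%:R * (1 + 2 * x)) g)%:R) <= 2 * eta.
Proof.
move=> x0 eta0 B hK hn; set s := Num.sqrt d%:R; set theta := s * (1 + 2 * x).
have s0 : 0 < s by rewrite sqrtr_gt0 ltr0n.
have sE : s ^+ 2 = d%:R by rewrite sqr_sqrtr ?ler0n.
(* [rho] lies strictly between 1 / theta and 1 / s: the ratio 1 / (1 + x) to the former gives decay
   in [K], and s * rho = r0 < 1 makes the expected series geometric. *)
pose r0 := (1 + x) / (1 + 2 * x); pose rho := r0 / s.
have x1 : 0 < 1 + x by lra.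
have x2 : 0 < 1 + 2 * x by lra.
have r0_gt0 : 0 < r0 by rewrite divr_gt0.
have r0_lt1 : r0 < 1 by rewrite ltr_pdivrMr //; lra.
have B0 : 0 < B by rewrite invr_gt0 subr_gt0.
have th0 : 0 < theta by rewrite mulr_gt0.
have rho0 : 0 < rho by rewrite divr_gt0.
have thq : theta^-1 / rho = (1 + x)^-1.
  by rewrite /theta /rho /r0; field; rewrite !gt_eqF.
have thr : theta^-1 <= rho.
  by rewrite -[leRHS]mul1r -ler_pdivrMr // thq invf_le1 //; lra.
pose F1 g := \sum_(i < n.+1) coef_norm R g i * rho ^+ i.
pose F2 g := \sum_(k < K) trace_norm R g k.+1 / k.+1%:R * rho ^+ k.+1.
have srho : s * rho = r0 by rewrite /rho mulrC divfK // gt_eqF.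
have BE : B = (1 - r0)^-1 by [].
clearbody rho r0 B.
have F1avg : avg F1 <= B.
  rewrite avg_sum; apply: le_trans (_ : \sum_(i < n.+1) r0 ^+ i <= _); last first.
    by rewrite BE; apply: geometric_sum_le; rewrite ltW.
  apply: ler_sum => i _.
  rewrite (_ : avg _ = rho ^+ i * avg (fun g => coef_norm R g i)); last first.
    by rewrite -avgZ; congr (avg _); apply/funext => g; rewrite mulrC.
  by rewrite -srho exprMn [leRHS]mulrC ler_wpM2l ?exprn_ge0 ?(ltW rho0) // avg_coef_norm.
have F2avg : avg F2 <= 4 * B.
  rewrite avg_sum; apply: le_trans (_ : \sum_(k < K) 4 * r0 ^+ k <= _); last first.
    by rewrite -mulr_sumr BE ler_wpM2l // geometric_sum_le // ltW.
  apply: ler_sum => k _.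
  rewrite (_ : avg _ = rho ^+ k.+1 / k.+1%:R * avg (fun g => trace_norm R g k.+1)); last first.
    by rewrite -avgZ; congr (avg _); apply/funext => g; rewrite mulrC mulrA mulrAC.
  have sk : s ^+ k.+1 ^+ 2 = d%:R ^+ k.+1 by rewrite exprAC sE.
  have := avg_walk_count n_gt0 d_gt0 (ltn0Sn k) (exprn_gt0 k.+1 s0) sk (hn k (ltn_ord k)).
  have rk : 0 <= rho ^+ k.+1 / k.+1%:R by rewrite divr_ge0 ?exprn_ge0 ?ler0n // ltW.
  move=> /(ler_wpM2l rk) /le_trans; apply.
  have -> : rho ^+ k.+1 / k.+1%:R * ((4 * k.+1)%:R * s ^+ k.+1) = 4 * (s * rho) ^+ k.+1.
    have m0 : k.+1%:R != 0 :> R by rewrite pnatr_eq0.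
    by rewrite exprMn natrM; move: (k.+1%:R : R) m0 => m m0; field.
  by rewrite srho ler_wpM2l // exprS ler_piMl ?exprn_ge0 ?ltW.
(* Markov's inequality for both factors at once, as a pointwise bound on the indicator. *)
apply: (@le_trans _ _ (avg (fun g => eta / B * F1 g + eta / (4 * B) * F2 g))); last first.
  have -> : 2 * eta = eta + eta by ring.
  rewrite avgD !avgZ; apply: lerD.
    by rewrite mulrAC ler_pdivrMr // ler_wpM2l // ltW.
  by rewrite mulrAC ler_pdivrMr ?mulr_gt0 // ler_wpM2l // ltW.
have F10 g : 0 <= F1 g.
  by apply: sumr_ge0 => i _; rewrite mulr_ge0 ?divr_ge0 ?ler0n ?exprn_ge0 // ltW.
have F20 g : 0 <= F2 g.
  apply: sumr_ge0 => i _; apply: mulr_ge0; last by rewrite exprn_ge0 // ltW.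
  by apply: divr_ge0; [exact: normr_ge0|].
have B40 : 0 < 4 * B by rewrite mulr_gt0.
have eB1 g : 0 <= eta / B * F1 g by rewrite mulr_ge0 // divr_ge0 // ltW.
have eB2 g : 0 <= eta / (4 * B) * F2 g by rewrite mulr_ge0 // divr_ge0 // ltW.
apply: avg_le => g; have [/asboolP[z [rz zt]]|_] := boolP (has_large_root theta g); last first.
  by rewrite addr_ge0.
have := large_root_bound n_gt0 K th0 rho0 thr rz zt; rewrite thq -/(F1 g) -/(F2 g) => H.
have [F1B|F1B] := leP (B / eta) (F1 g).
  by rewrite ler_wpDr // -[eta / B]invf_div mulrC ler_pdivlMr ?divr_gt0 // mul1r.
have [F2B|F2B] := leP (4 * B / eta) (F2 g).
  by rewrite ler_wpDl // -[eta / _]invf_div mulrC ler_pdivlMr ?divr_gt0 // mul1r.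
suff : (1 : R) < 1 by rewrite ltxx.
apply: le_lt_trans hK; apply: (le_trans H).
rewrite ler_wpM2l ?exprn_ge0 ?invr_ge0 ?(ltW x1) // ler_pM ?(ltW F1B) //.
  by apply: sumr_ge0 => j _; rewrite mulr_ge0 ?invr_ge0 ?ler0n ?exprn_ge0.
apply: (le_trans (trunc_exp_mono K (F20 g) (ltW F2B))).
by apply: trunc_exp_le_expR; rewrite divr_ge0 ?mulr_ge0 // ltW.
Qed.

End ExceptionalProbability.

Section SecondEigenvalue.

Variables (R : realType) (n d : nat).
Hypothesis n_gt0 : (0 < n)%N.
Local Notation G := {ffun 'I_d -> 'S_n}.
Local Notation toC := (real_complex R).
Implicit Types (g : G) (l : n.-tuple R[i]).

Lemma map_perm_sum g : map_mx toC (perm_sum R g) = sum_perm_mx R g.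
Proof.
apply/matrixP => i j; rewrite !mxE perm_sumE rmorph_sum summxE.
by apply: eq_bigr => s _; rewrite !mxE rmorph_nat.
Qed.

(** Up to one zero, the eigenvalues of A are d and those of the centred matrix; so at most one,
    namely d, exceeds [theta] in modulus, whereas a large second entry would give two. *)
Lemma second_modulus_le g l (theta : R) : 0 <= theta ->
  ordered_eigenvalues (sum_perm_mx R g) l -> ~~ has_large_root theta g ->
  `|l`_1| <= toC theta.
Proof.
move=> th0 [cl sl] /asboolPn nolarge.
have [m [cm _ _]] := eigenvalue_list (map_mx toC (centered_sum R g)) n_gt0.
have lm : perm_eq (0 :: l) (toC d%:R :: m).
  apply: prod_XsubC_eq; rewrite !big_cons subr0 -cl -cm.
  have := congr1 (map_poly toC) (char_poly_perm_sum R n_gt0 g).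
  rewrite !rmorphM /= rmorphB /= map_polyX map_polyC !map_char_poly map_perm_sum => E.
  by rewrite mulrC E mulrC.
pose P (z : R[i]) := toC theta < `|z|.
have mP : count P m = 0%N.
  apply/eqP; rewrite -leqn0 leqNgt -has_count; apply/hasPn => z zm.
  apply/negP => Pz; apply: nolarge; exists z; split=> //.
  by rewrite cm root_prod_XsubC.
have th_real : toC theta \is Num.real by rewrite ger0_real // -[0]/(toC 0) lecR.
rewrite real_leNgt ?normr_real //; apply/negP => l1.
have := seq.permP lm P; rewrite /= mP addn0.
(* For a list of length at most one, the entry of index 1 is the default 0. *)
move: sl l1; case: (tval l) => [|a [|b s]] /=.
- by move=> _; rewrite normr0 -[0]/(toC 0) ltcR ltNge th0.
- by move=> _; rewrite normr0 -[0]/(toC 0) ltcR ltNge th0.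
move=> /andP[ba _] bth.
have -> : P b by [].
have -> : P a by rewrite /P (lt_le_trans bth).
by case: (P 0); case: (P _); lia.
Qed.

(** Ties may be broken in several ways, but the sorted list of moduli is unique. *)
Lemma second_modulus_unique (A : 'M[R[i]]_n) l l' :
  ordered_eigenvalues A l -> ordered_eigenvalues A l' -> `|l`_1| = `|l'`_1|.
Proof.
move=> [cl sl] [cl' sl'].
have ll' : perm_eq l l' by apply: prod_XsubC_eq; rewrite -cl -cl'.
have nth1 (s : n.-tuple R[i]) : `|s`_1| = nth 0 [seq `|z| | z <- s] 1.
  have [s1|s1] := ltnP 1 (size s); first by rewrite (nth_map 0).
  by rewrite !nth_default ?size_map ?normr0.
rewrite !nth1; congr (nth 0 _ 1).
apply: (@sorted_eq _ (fun x y : R[i] => y <= x)).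
- by move=> x y z yx zy; apply: le_trans yx.
- by move=> x y /andP[yx xy]; apply: le_anti; rewrite yx xy.
- by rewrite sorted_map.
- by rewrite sorted_map.
- exact: perm_map.
Qed.

End SecondEigenvalue.

Local Open Scope classical_set_scope.
Local Open Scope ring_scope.

(** * From the probability space to the uniform average over families of permutations *)

Section JointLaw.

Variables (R : realType) (disp : measure_display) (T : measurableType disp).
Variables (P : probability T R) (I V : finType) (X : I -> T -> V).
Hypothesis X_iid : iid_uniform P X.

Definition joint_value (w : T) : {ffun I -> V} := [ffun i => X i w].

Lemma joint_value_preimage (v : {ffun I -> V}) :
  joint_value @^-1` [set v] = \bigcap_(i in [set` (finset.setTfor I)]) (X i @^-1` [set v i]).
Proof.
apply/seteqP; split=> w /=; first by move=> <- i _ /=; rewrite ffunE.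
by move=> H; apply/ffunP => i; rewrite ffunE; apply: H; rewrite /= inE.
Qed.

Lemma measurable_joint_value (v : {ffun I -> V}) : measurable (joint_value @^-1` [set v]).
Proof.
have [mX _ _] := X_iid; rewrite joint_value_preimage.
by apply: fin_bigcap_measurable => // i _; apply: mX.
Qed.

Lemma prob_joint_value (v : {ffun I -> V}) :
  P (joint_value @^-1` [set v]) = (#|{ffun I -> V}|%:R^-1)%:E.
Proof.
have [_ uX iX] := X_iid; rewrite joint_value_preimage.
rewrite (iX (finset.setTfor I) (fun i => [set v i])).
under eq_bigr do rewrite uX.
rewrite -(big_morph EFin (@EFinM R) (erefl _)) prodr_const cardsT card_ffun natrX.
by rewrite exprVn.
Qed.

Lemma prob_joint_set (S : {set {ffun I -> V}}) :
  measurable (joint_value @^-1` [set` S]) /\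
  P (joint_value @^-1` [set` S]) = (#|S|%:R / #|{ffun I -> V}|%:R)%:E.
Proof.
elim/set_U1_ind: S => [|v S vS [mS IH]].
  rewrite (_ : _ @^-1` _ = set0); last by apply/seteqP; split=> w //=; rewrite inE.
  by rewrite measure0 cards0 mul0r.
have -> : joint_value @^-1` [set` (v |: S)%SET] =
    joint_value @^-1` [set v] `|` joint_value @^-1` [set` S].
  apply/seteqP; split=> w /=; rewrite in_setU1; first by case/orP => [/eqP|]; [left|right].
  by case=> [->|->]; rewrite ?eqxx ?orbT.
have mv := measurable_joint_value v.
split; first exact: measurableU.
rewrite measureU //; last first.
  by apply/seteqP; split=> w //= [wv]; rewrite wv (negPf vS).
transitivity ((#|{ffun I -> V}|%:R^-1 : R)%:E + (#|S|%:R / #|{ffun I -> V}|%:R)%:E)%E.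
  by congr (_ + _)%E; [exact: prob_joint_value|exact: IH].
rewrite -EFinD cardsU1 vS.
by rewrite natrD mulrDl mul1r.
Qed.

End JointLaw.

(** * Growth of [d] and the conclusion *)

Section Eventually.

Variables (R : realType) (d : nat -> nat).
Hypotheses (d_gt0 : forall n, (0 < n)%N -> (0 < d n)%N)
  (d_cvg : d @ \oo --> \oo)
  (d_subpoly : (fun n => ln (d n)%:R : R^o) =o_\oo (fun n => ln n%:R : R^o)).

Lemma eventually_pow_le K : \forall n \near \oo, (d n ^ K <= n)%N.
Proof.
have K0 : 0 < (K.+1%:R : R)^-1 by rewrite invr_gt0 ltr0n.
have /eqoP /(_ _ K0) := d_subpoly.
move=> H; near=> n.
have n0 : (0 < n)%N by near: n; exists 1%N.
have lnn : 0 <= ln (n%:R : R) by rewrite ln_ge0 // ler1n.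
have lnd : 0 <= ln ((d n)%:R : R) by rewrite ln_ge0 // ler1n d_gt0.
have : `|ln ((d n)%:R : R)| <= K.+1%:R^-1 * `|ln (n%:R : R)| by near: n.
rewrite !ger0_norm // mulrC ler_pdivlMr ?ltr0n // => dn.
rewrite -(ler_nat R) natrX -ler_ln ?posrE ?exprn_gt0 ?ltr0n ?d_gt0 //.
rewrite lnXn ?ltr0n ?d_gt0 //; apply: le_trans dn.
by rewrite mulr_natr mulrS lerDr.
Unshelve. all: by end_near. Qed.

(** As d tends to infinity it eventually exceeds the constant [C], so the left side is at most
    d^(2K+1), itself eventually at most n. *)
Lemma eventually_threshold K : \forall n \near \oo,
  forall k, (k < K)%N -> (walk_threshold k.+1 * d n ^ (2 * k.+1) <= n)%N.
Proof.
pose C := (\max_(k < K) walk_threshold k.+1)%N.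
near=> n => k kK.
have n0 : (0 < n)%N by near: n; exists 1%N.
have dn0 : (0 < d n)%N by rewrite d_gt0.
have dC : (C <= d n)%N by near: n; exact: (d_cvg (nbhs_infty_ge C)).
apply: (@leq_trans (d n ^ (2 * K).+1)%N); last by near: n; apply: eventually_pow_le.
rewrite expnS leq_mul //; last by rewrite leq_pexp2l // leq_mul2l.
exact: leq_trans (leq_bigmax (Ordinal kK)) dC.
Unshelve. all: by end_near. Qed.

End Eventually.

Lemma exists_expr_lt1 (R : realType) (x M : R) : 0 < x -> 0 <= M ->
  exists K, (1 + x)^-1 ^+ K.+1 * M < 1.
Proof.
move=> x0 M0; pose K := Num.bound (M / x); exists K.
have x1 : 0 < 1 + x by rewrite addr_gt0.
rewrite exprVn mulrC ltr_pdivrMr ?exprn_gt0 // mul1r.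
have MK : M / x < K%:R by apply: archi_boundP; rewrite divr_ge0 // ltW.
have : 1 + K.+1%:R * x <= (1 + x) ^+ K.+1.
  elim: (K.+1) => [|j IH]; first by rewrite mul0r addr0 expr0.
  rewrite exprS -natr1; have j0 : 0 <= j%:R * x :> R by rewrite mulr_ge0 // ltW.
  have := ler_wpM2l (ltW x1) IH; nra.
apply: lt_le_trans; move: MK; rewrite ltr_pdivrMr // -natr1.
by nra.
Qed.

Theorem theorem1p2 (R : realType) (d : nat -> nat)
  (d_gt0 : forall n, (0 < n)%N -> (0 < d n)%N)
  (d_cvg : d @ \oo --> \oo)
  (d_subpoly :
     (fun n => ln (d n)%:R : R^o) =o_\oo (fun n => ln n%:R : R^o))
  (disp : nat -> measure_display)
  (Omega : forall n, measurableType (disp n))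
  (P : forall n, probability (Omega n) R)
  (sigma : forall n, 'I_(d n) -> Omega n -> 'S_n)
  (sigma_iid : forall n, iid_uniform (P n) (@sigma n))
  (lambda : forall n, Omega n -> n.-tuple R[i])
  (lambda_spec : forall n w,
     ordered_eigenvalues (sum_perm_mx R (fun j => @sigma n j w))
                         (lambda n w))
  (eps : R) (eps_gt0 : 0 < eps) :
  P n [set w | ((Num.sqrt (d n)%:R * (1 + eps))%:C)%C < `|(lambda n w)`_1| ]
    @[n --> \oo] --> 0%E.
Proof.
pose E n := [set w | ((Num.sqrt (d n)%:R * (1 + eps))%:C)%C < `|(lambda n w)`_1|].
(* [lambda n] may break ties differently from point to point, but by [second_modulus_unique] the
   event depends only on the joint value of the permutations: it is the preimage of [S n], which
   gives its measurability and its probability. *)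
pose S n : {set {ffun 'I_(d n) -> 'S_n}} :=
  [set g | `[< exists2 w, joint_value (@sigma n) w = g & E n w >]]%SET.
have ES n : E n = joint_value (@sigma n) @^-1` [set` S n].
  apply/seteqP; split=> w /=; rewrite inE; first by move=> Ew; apply/asboolP; exists w.
  move=> /asboolP[w' ww' Ew']; rewrite /E /=.
  have Aw : sum_perm_mx R (fun j => @sigma n j w) = sum_perm_mx R (fun j => @sigma n j w').
    apply: eq_bigr => j _; congr perm_mx.
    by move/ffunP: ww' => /(_ j); rewrite !ffunE.
  have lw := lambda_spec n w; rewrite Aw in lw.
  by rewrite (second_modulus_unique lw (lambda_spec n w')).
have PE n : P n (E n) = (#|S n|%:R / #|{ffun 'I_(d n) -> 'S_n}|%:R)%:E.
  by rewrite ES; have [_ ->] := prob_joint_set (sigma_iid n) (S n).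
rewrite (_ : (fun n => _) = (fun n => (#|S n|%:R / #|{ffun 'I_(d n) -> 'S_n}|%:R)%:E)); last first.
  by apply/funext => n; exact: PE.
apply: cvg_EFin; first by near=> n.
apply/cvgr0Pnorm_le => e e0 /=.
(* 1 + 2 x is then 1 + eps, leaving room for the intermediate radius; [eta] is half of [e] because
   two Markov bounds are added. *)
pose x := eps / 2; have x0 : 0 < x by rewrite divr_gt0.
pose eta := e / 2; have eta0 : 0 < eta by rewrite divr_gt0.
pose B := (1 - (1 + x) / (1 + 2 * x))^-1.
have B0 : 0 <= B.
  by rewrite invr_ge0 subr_ge0 ler_pdivrMr; lra.
have M0 : 0 <= B / eta * expR (4 * B / eta).
  by rewrite mulr_ge0 ?expR_ge0 // divr_ge0 // ltW.
have [K hK] := exists_expr_lt1 x0 M0.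
near=> n.
have n0 : (0 < n)%N by near: n; exists 1%N.
have hn : forall k, (k < K)%N -> (walk_threshold k.+1 * d n ^ (2 * k.+1) <= n)%N.
  by near: n; exact: (eventually_threshold d_gt0 d_cvg d_subpoly K).
have := avg_large_root n0 (d_gt0 n n0) x0 eta0 hK hn.
have -> : 1 + 2 * x = 1 + eps by rewrite /x; lra.
have -> : 2 * eta = e by rewrite /eta; lra.
rewrite ger0_norm ?divr_ge0 ?ler0n //; apply: le_trans.
rewrite /avg ler_wpM2r ?invr_ge0 ?ler0n // -sum1_card natr_sum big_mkcond /=.
apply: ler_sum => g _; rewrite inE; case: asboolP => [[w wg Ew]|_]; last by rewrite ler0n.
have [//|small] := boolP (has_large_root (Num.sqrt (d n)%:R * (1 + eps)) g).
have lw : ordered_eigenvalues (sum_perm_mx R g) (lambda n w).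
  rewrite (_ : sum_perm_mx R g = sum_perm_mx R (fun j => @sigma n j w)) //.
  by apply: eq_bigr => j _; rewrite -wg ffunE.
have th0 : 0 <= Num.sqrt (d n)%:R * (1 + eps) by rewrite mulr_ge0 ?sqrtr_ge0 // addr_ge0 // ltW.
by have := lt_le_trans Ew (second_modulus_le n0 th0 lw small); rewrite ltxx.
Unshelve. all: by end_near.
Qed.
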